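(* Let $\mu$ be a friendly measure on $\mathbb{R}^n$, let $\mathbf{r}=(r_1,\dots,r_n)$ satisfy $r_i>0$ for all $i$ and $\sum_{i=1}^n r_i=1$, and let $\mathcal{T}\subset\mathbb{R}_{\ge 1}=[1,\infty)$ be any unbounded subset. Then $\mu\big(\mathrm{Sing}(\mathbf{r},\mathcal{T})\big)=0$.
   Context: Singular vectors. For $\mathbf{x}=(x_1,\dots,x_n)\in\mathbb{R}^n$ put $\|\mathbf{x}\|_{\mathbf{r}}=\max_{1\le i\le n}|x_i|^{1/r_i}$. Here $\mathbb{N}=\{1,2,\dots\}$. For unbounded $\mathcal{T}\subset[1,\infty)$, a vector $\mathbf{x}\in\mathbb{R}^n$ is $\mathbf{r}$-singular along $\mathcal{T}$ if for every $\delta>0$ there is $T_0$ such that for all $T\in\mathcal{T}\cap[T_0,\infty)$ there exist $\mathbf{p}\in\mathbb{Z}^n$ and $q\in\mathbb{N}$ with $\|q\mathbf{x}-\mathbf{p}\|_{\mathbf{r}}<\delta/T$ and $q<\delta T$. $\mathrm{Sing}(\mathbf{r},\mathcal{T})$ is the set of vectors in $\mathbb{R}^n$ that are $\mathbf{r}$-singular along $\mathcal{T}$. Friendly measures. Let $\mu$ be a locally finite Borel measure on $\mathbb{R}^n$, with support $\mathrm{supp}\,\mu$, and let $B(\mathbf{x},r)$ denote the open Euclidean ball of radius $r$ centered at $\mathbf{x}$. - For $U\subset\mathbb{R}^n$ open and $D>0$, $\mu$ is $D$-Federer on $U$ if for all $\mathbf{x}\in\mathrm{supp}\,\mu\cap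 U$ one has $\mu(B(\mathbf{x},3r))/\mu(B(\mathbf{x},r))<D$ whenever $B(\mathbf{x},3r)\subset U$. - $\mu$ is nonplanar if $\mu(\mathcal{L})=0$ for every affine hyperplane $\mathcal{L}\subset\mathbb{R}^n$. - For an affine subspace $\mathcal{L}$, $d_{\mathcal{L}}(\mathbf{x})$ is the Euclidean distance from $\mathbf{x}$ to $\mathcal{L}$ and $\mathcal{L}^{(\varepsilon)}=\{\mathbf{x}\in\mathbb{R}^n: d_{\mathcal{L}}(\mathbf{x})<\varepsilon\}$. For $B\subset\mathbb{R}^n$ with $\mu(B)>0$ and $f:\mathbb{R}^n\to\mathbb{R}$, $\|f\|_{\mu,B}=\sup_{\mathbf{x}\in B\cap\mathrm{supp}\,\mu}|f(\mathbf{x})|$. - For $C,\alpha>0$ and $U$ open, $\mu$ is $(C,\alpha)$-decaying on $U$ if for every non-empty open ball $B\subset U$ centered in $\mathrm{supp}\,\mu$, every affine hyperplane $\mathcal{L}\subset\mathbb{R}^n$ and every $\varepsilon>0$, $\mu(B\cap\mathcal{L}^{(\varepsilon)})\le C\left(\frac{\varepsilon}{\|d_{\mathcal{L}}\|_{\mu,B}}\right)^{\alpha}\mu(B)$. - $\mu$ is friendly if it is nonplanar and for $\mu$-a.e. $\mathbf{x}\in\mathbb{R}^n$ there exist a neighborhood $U$ of $\mathbf{x}$ and $C,\alpha,D>0$ such that $\mu$ is $D$-Federer and $(C,\alpha)$-decaying on $U$. *)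

(* Defs.v *)
From HB Require Import structures.
From mathcomp Require Import all_boot all_order all_algebra.
From mathcomp Require Import all_classical all_reals all_analysis.

Set Implicit Arguments.
Unset Strict Implicit.
Unset Printing Implicit Defensive.

Import Order.TTheory GRing.Theory Num.Theory.
Import numFieldNormedType.Exports.

Local Open Scope classical_set_scope.
Local Open Scope ring_scope.

(* ['rV[R]_n] carries no canonical sigma-algebra; [borelRV R n] is the same
   type equipped with the sigma-algebra generated by its open sets. *)
Notation borelRV R n := (g_sigma_algebraType (@open 'rV[R]_n)).

Section Euclidean.
Variables (R : realType) (n : nat).
Implicit Types (x : 'rV[R]_n) (L : set 'rV[R]_n).

(* The library norm on ['rV[R]_n] is the sup norm, hence the explicit
   Euclidean norm. *)
Definition enorm x : R := Num.sqrt (\sum_(i < n) x 0 i ^+ 2).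

Definition eball x (rho : R) : set 'rV[R]_n := [set y | enorm (y - x) < rho].

Definition affine_hyperplane L : Prop :=
  exists (a : 'rV[R]_n) (b : R),
    a != 0 /\ L = [set x | \sum_(i < n) a 0 i * x 0 i = b].

Definition edistance L x : R := inf [set enorm (x - y) | y in L].

Definition thickening L (eps : R) : set 'rV[R]_n :=
  [set x | edistance L x < eps].

End Euclidean.

Section Friendly.
Variables (R : realType) (n : nat).
Variable mu : {measure set (borelRV R n) -> \bar R}.
Implicit Types (U B L : set 'rV[R]_n).

Definition locally_finite : Prop :=
  forall x : 'rV[R]_n, exists U, [/\ open U, U x & (mu U < +oo)%E].

Definition msupp : set 'rV[R]_n :=
  [set x | forall U, open U -> U x -> (0 < mu U)%E].

Definition federer (D : R) U : Prop :=
  forall (x : 'rV[R]_n) (rho : R), msupp x -> U x -> 0 < rho ->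
    eball x (3 * rho) `<=` U ->
    (mu (eball x (3 * rho)) / mu (eball x rho) < D%:E)%E.

Definition nonplanar : Prop :=
  forall L, affine_hyperplane L -> mu L = 0%E.

Definition supnorm (f : 'rV[R]_n -> R) B : \bar R :=
  ereal_sup [set (`|f x|)%:E | x in B `&` msupp].

(* Extended-real division has [c / 0 = +oo] for [c > 0], so the condition is
   vacuous when [L] contains [B `&` msupp]. *)
Definition decaying (C alpha : R) U : Prop :=
  forall (x : 'rV[R]_n) (rho : R) L (eps : R),
    msupp x -> 0 < rho -> eball x rho `<=` U ->
    affine_hyperplane L -> 0 < eps ->
    (mu (eball x rho `&` thickening L eps) <=
      C%:E * (eps%:E / supnorm (edistance L) (eball x rho)) `^ alpha
        * mu (eball x rho))%E.

Definition friendly : Prop :=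
  nonplanar /\
  {ae mu, forall x : 'rV[R]_n,
     exists (U : set 'rV[R]_n) (C alpha D : R),
       [/\ open U, U x, [/\ 0 < C, 0 < alpha & 0 < D],
           federer D U & decaying C alpha U]}.

End Friendly.

Section Singular.
Variables (R : realType) (n : nat).
Implicit Types (x : 'rV[R]_n) (r : 'I_n -> R) (T : set R).

(* The neutral element [0] is harmless: all the terms are nonnegative. *)
Definition wnorm r x : R :=
  \big[Num.max/0]_(i < n) (`|x 0 i| `^ (r i)^-1).

Definition singular_along r T x : Prop :=
  forall delta : R, 0 < delta ->
    exists T0 : R, forall t : R, T t -> T0 <= t ->
      exists (p : 'rV[int]_n) (q : nat),
        [/\ (0 < q)%N,
            wnorm r (q%:R *: x - map_mx intr p) < delta / t &
            q%:R < delta * t].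

Definition Sing r T : set 'rV[R]_n := [set x | singular_along r T x].

End Singular.

(* Main.v *)
Require Import Defs.
From HB Require Import structures.
From mathcomp Require Import all_boot all_order all_algebra.
From mathcomp Require Import all_classical all_reals all_analysis.
From mathcomp Require Import ring lra.

Set Implicit Arguments.
Unset Strict Implicit.
Unset Printing Implicit Defensive.

Import Order.TTheory GRing.Theory Num.Theory.
Import numFieldNormedType.Exports.

Local Open Scope classical_set_scope.
Local Open Scope ring_scope.

(** By Dani's correspondence, [x] is singular along [T] only if for every
    [eta > 0] the lattice spanned by the rows of [u_x g_t] has a nonzero vector
    of norm at most [eta] for all large [t] in [T]. It therefore suffices to
    bound, uniformly in large [t], the measure of the [x] in a small ball [B]
    for which this lattice has a short vector by [K eps^alpha mu(B)]; this is
    the quantitative nondivergence of Kleinbock and Margulis. To each primitive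
    sublattice one attaches the maximum of its Plücker coordinates after [u_x
    g_t]. These are affine in [x] because [u_x] is a rank-one perturbation of
    the identity, so the decay condition applies to them, and nonplanarity makes
    their supremum over [B] at least 1 for large [t]. The bound follows by
    induction on the length of a flag of sublattices whose functions lie in
    [[eps, 1]] at [x]: around each bad point the flag is enlarged by a lattice
    whose function is below 1 on an almost maximal ball, and these balls are
    assembled with the Federer condition and a Vitali selection. The induction
    stops because a short vector at [x] always allows one to enlarge the flag. *)

(** * Euclidean geometry *)

Section Geometry.
Variables (R : realType) (n : nat).
Implicit Types (x y z a : 'rV[R]_n) (e s b : R).

Definition dotp a x : R := \sum_(i < n) a 0 i * x 0 i.

Lemma dotpC a x : dotp a x = dotp x a.
Proof. by apply: eq_bigr => i _; rewrite mulrC. Qed.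

Lemma dotpDr a x y : dotp a (x + y) = dotp a x + dotp a y.
Proof. by rewrite -big_split; apply: eq_bigr => i _; rewrite mxE mulrDr. Qed.

Lemma dotpZr a e x : dotp a (e *: x) = e * dotp a x.
Proof. by rewrite mulr_sumr; apply: eq_bigr => i _; rewrite mxE mulrCA. Qed.

Lemma dotpBr a x y : dotp a (x - y) = dotp a x - dotp a y.
Proof. by rewrite -scaleN1r dotpDr dotpZr mulN1r. Qed.

Lemma dotp_ge0 x : 0 <= dotp x x.
Proof. by apply: sumr_ge0 => i _; rewrite -expr2 sqr_ge0. Qed.

Lemma enormE x : enorm x = Num.sqrt (dotp x x).
Proof. by congr Num.sqrt; apply: eq_bigr => i _; rewrite expr2. Qed.

Lemma enorm_ge0 x : 0 <= enorm x.
Proof. exact: sqrtr_ge0. Qed.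

Lemma sqr_enorm x : enorm x ^+ 2 = dotp x x.
Proof. by rewrite enormE sqr_sqrtr ?dotp_ge0. Qed.

Lemma enormZ e x : enorm (e *: x) = `|e| * enorm x.
Proof.
by rewrite !enormE dotpZr dotpC dotpZr mulrA -expr2 sqrtrM ?sqr_ge0// sqrtr_sqr.
Qed.

Lemma enormN x : enorm (- x) = enorm x.
Proof. by rewrite -scaleN1r enormZ normrN normr1 mul1r. Qed.

Lemma enorm0 : enorm (0 : 'rV[R]_n) = 0.
Proof. by rewrite -(scale0r 0) enormZ normr0 mul0r. Qed.

Lemma enorm_eq0 x : (enorm x == 0) = (x == 0).
Proof.
apply/idP/eqP => [|->]; last by rewrite enorm0.
rewrite -sqrf_eq0 sqr_enorm psumr_eq0 => [/allP h|i _]; last first.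
  by rewrite -expr2 sqr_ge0.
apply/rowP => i; rewrite mxE; apply/eqP.
by have := h i (mem_index_enum i); rewrite /= mulf_eq0 orbb.
Qed.

Lemma enorm_gt0 x : (0 < enorm x) = (x != 0).
Proof. by rewrite lt_def enorm_ge0 enorm_eq0 andbT. Qed.

Lemma cauchy_schwarz a x : `|dotp a x| <= enorm a * enorm x.
Proof.
have [->|a0] := eqVneq a 0.
  by rewrite /dotp big1 ?normr0 ?mulr_ge0 ?enorm_ge0// => i _; rewrite mxE mul0r.
have aa0 : 0 < dotp a a by rewrite -sqr_enorm exprn_gt0// enorm_gt0.
rewrite -ler_sqr ?nnegrE ?mulr_ge0 ?enorm_ge0// real_normK ?num_real//.
rewrite exprMn !sqr_enorm.
(* The square of [(a.a) x - (a.x) a] is nonnegative; dividing it by [a.a] leaves the claim. *)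
have := dotp_ge0 (dotp a a *: x - dotp a x *: a).
rewrite !(dotpBr, dotpZr) !(dotpC (_ - _)) !(dotpBr, dotpZr) (dotpC x a) => h.
rewrite -(ler_pM2l aa0); nra.
Qed.

Lemma enormD x y : enorm (x + y) <= enorm x + enorm y.
Proof.
rewrite -ler_sqr ?nnegrE ?addr_ge0 ?enorm_ge0// sqrrD !sqr_enorm.
rewrite dotpDr !(dotpC (_ + _)) !dotpDr (dotpC y x).
have := le_trans (ler_norm _) (cauchy_schwarz x y); lra.
Qed.

Lemma enormB x y : enorm (x - y) = enorm (y - x).
Proof. by rewrite -enormN opprB. Qed.

Lemma enorm_triangle y x z : enorm (x - z) <= enorm (x - y) + enorm (y - z).
Proof. by have := enormD (x - y) (y - z); rewrite addrA subrK. Qed.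

Lemma sum_continuous (J : finType) (f : J -> 'rV[R]_n -> R) :
  (forall j, continuous (f j)) -> continuous (fun x => \sum_j f j x).
Proof.
by move=> fc; apply: continuous_big => [|j _]; [exact: add_continuous|exact: fc].
Qed.

Lemma enorm_continuous : continuous (@enorm R n).
Proof.
move=> x; apply: (@continuous_comp _ _ _ (fun x => \sum_i x 0 i ^+ 2) Num.sqrt);
  last exact: sqrt_continuous.
apply: (@sum_continuous _ (fun i x => x 0 i ^+ 2)) => i {}x.
apply: (@continuous_comp _ _ _ (fun x => x 0 i) (fun t => t ^+ 2)).
  exact: coord_continuous.
exact: exprn_continuous.
Qed.

Lemma dotp_continuous a : continuous (dotp a).
Proof.
apply: (@sum_continuous _ (fun i x => a 0 i * x 0 i)) => i x.
apply: (@continuousM R _ (fun=> a 0 i) (fun x : 'rV[R]_n => x 0 i)).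
  exact: cst_continuous.
exact: coord_continuous.
Qed.

Lemma eball_open x e : open (eball x e).
Proof.
have -> : eball x e = (fun y => enorm (y - x)) @^-1` [set t | t < e] by [].
apply: open_comp; last exact: open_lt.
move=> y _; apply: (@continuous_comp _ _ _ (fun y => y - x) (@enorm R n)).
  by apply: (@continuousB R _ _ id (fun=> x)); [exact: cvg_id|exact: cst_continuous].
exact: enorm_continuous.
Qed.

Lemma eball_center x e : 0 < e -> eball x e x.
Proof. by move=> e0; rewrite /eball /= subrr enorm0. Qed.

Lemma subset_eball x y e s : enorm (x - y) + e <= s -> eball x e `<=` eball y s.
Proof.
move=> h z; rewrite /eball /= => zx.
by have := enorm_triangle x z y; lra.
Qed.

Lemma coord_le_enorm x i : `|x 0 i| <= enorm x.
Proof.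
rewrite -ler_sqr ?nnegrE ?enorm_ge0// real_normK ?num_real// sqr_enorm.
rewrite /dotp (bigD1 i)//= -expr2 lerDl sumr_ge0// => j _.
by rewrite -expr2 sqr_ge0.
Qed.

Lemma enorm_le_sum x : enorm x <= \sum_i `|x 0 i|.
Proof.
have s0 : 0 <= \sum_i `|x 0 i| by apply: sumr_ge0.
rewrite -ler_sqr ?nnegrE ?enorm_ge0// sqr_enorm expr2 mulr_suml.
apply: ler_sum => i _; apply: le_trans (ler_norm _) _; rewrite normrM.
by rewrite ler_wpM2l// (bigD1 i)//= lerDl sumr_ge0.
Qed.

(** The topology comes from the sup norm, which the Euclidean norm dominates, so a sup-norm ball
    inside [U] contains the Euclidean ball of the same radius. *)
Lemma open_eball U x : open U -> U x -> exists2 e, 0 < e & eball x e `<=` U.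
Proof.
move=> oU Ux; have /nbhs_ballP [e /= e0 eU] := open_nbhs_nbhs (conj oU Ux).
exists e => // y yx; apply: eU; split => // i j.
rewrite ord1 /ball/= distrC.
by have := coord_le_enorm (y - x) j; rewrite !mxE => /le_lt_trans; exact.
Qed.

(** A base of the topology indexed by a countable type, so that [pickle] enumerates it. *)
Definition rat_eball (c : 'rV[rat]_n * nat) : set 'rV[R]_n :=
  eball (map_mx ratr c.1) c.2.+1%:R^-1.

Lemma rat_eball_basis U x : open U -> U x ->
  exists c, rat_eball c x /\ rat_eball c `<=` U.
Proof.
move=> oU Ux; have [e e0 eU] := open_eball oU Ux.
(* A basic ball of radius [1/(m+1)] containing [x] lies within [2/(m+1) < e] of [x]. Below, each
   coordinate is approximated to within [1/((m+1)(n+1))]; the denominator [n+1] makes the sum of the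
   [n] errors strictly smaller than [1/(m+1)]. *)
pose m := Num.truncn (2 / e).
have m0 : 0 < m.+1%:R^-1 :> R by rewrite invr_gt0.
have me : 2 * m.+1%:R^-1 < e.
  rewrite ltr_pdivrMr// mulrC -ltr_pdivrMr//; exact: truncnS_gt.
have n0 : 0 < (n.+1%:R : R) by [].
have /(_ _)/cid ch i : exists q : rat, `|x 0 i - ratr q| < m.+1%:R^-1 / n.+1%:R.
  have : 0 < m.+1%:R^-1 / n.+1%:R :> R by rewrite divr_gt0.
  move: (_ / _) => d d0; have lt_d : x 0 i - d < x 0 i + d by lra.
  have [q] := rat_in_itvoo lt_d.
  rewrite in_itv/= => /andP[q1 q2]; exists q.
  by rewrite ltr_norml; apply/andP; split; lra.
pose c : 'rV[rat]_n := \row_i sval (ch i).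
have cx : enorm (x - map_mx ratr c) < m.+1%:R^-1.
  apply: le_lt_trans (enorm_le_sum _) _.
  apply: (@le_lt_trans _ _ (\sum_(i < n) m.+1%:R^-1 / n.+1%:R)).
    by apply: ler_sum => i _; rewrite !mxE; exact: ltW (svalP (ch i)).
  rewrite sumr_const card_ord -[X in X < _]mulr_natl mulrCA gtr_pMr//.
  by rewrite ltr_pdivrMr// mul1r ltr_nat.
exists (c, m); split; first by [].
apply: subset_trans eU; apply: subset_eball.
rewrite enormB /=; move: cx me; move: (_^-1) (enorm _) => d w; lra.
Qed.

(** To each basic ball contained in some [V x] one such [x] is attached, and [None] to the others. A
    point [y] is then covered through a basic ball between [y] and [V y]. *)
Lemma lindelof (X : set 'rV[R]_n) (V : 'rV[R]_n -> set 'rV[R]_n) :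
  (forall x, X x -> open (V x) /\ V x x) ->
  exists f : nat -> option 'rV[R]_n,
    (forall k x, f k = Some x -> X x) /\
    (forall y, X y -> exists k x, f k = Some x /\ V x y).
Proof.
move=> XV.
pose P (k : nat) x := exists c, unpickle k = Some c /\
  X x /\ rat_eball c `<=` V x.
pose f k : option 'rV[R]_n := if pselect (exists x, P k x) is left e
  then Some (projT1 (cid e)) else None.
exists f; split=> [k x|y Xy].
  rewrite /f; case: pselect => // e [<-].
  by case: (cid e) => /= z [c [_ []]].
have [oV Vy] := XV _ Xy; have [c [cy cV]] := rat_eball_basis oV Vy.
exists (pickle c); rewrite /f; case: pselect => [e|[]]; last first.
  by exists y, c; rewrite pickleK.
exists (projT1 (cid e)); split => //.
case: (cid e) => /= z [c'] [+ [_ cz]]; rewrite pickleK => -[cc].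
by apply: cz; rewrite -cc.
Qed.

Definition hyperplane a b : set 'rV[R]_n := [set x | dotp a x = b].

(** The foot [p] of the perpendicular attains the distance, and Cauchy-Schwarz shows that no other
    point is closer. *)
Lemma edistance_hyperplane a b y : a != 0 ->
  edistance (hyperplane a b) y = `|dotp a y - b| / enorm a.
Proof.
move=> a0; have na0 : 0 < enorm a by rewrite enorm_gt0.
have aa : dotp a a = enorm a ^+ 2 by rewrite sqr_enorm.
pose p := y - ((dotp a y - b) / enorm a ^+ 2) *: a.
have pL : hyperplane a b p.
  rewrite /hyperplane /= /p dotpBr dotpZr aa divfK ?expf_neq0 ?gt_eqF//.
  by rewrite opprB addrC subrK.
have py : enorm (y - p) = `|dotp a y - b| / enorm a.
  rewrite /p opprB addrC subrK enormZ normrM normfV.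
  rewrite (ger0_norm (sqr_ge0 (enorm a))).
  by rewrite expr2 invfM mulrA mulfVK ?gt_eqF.
have lb z : hyperplane a b z -> `|dotp a y - b| / enorm a <= enorm (y - z).
  move=> <-; rewrite -dotpBr ler_pdivrMr// mulrC; exact: cauchy_schwarz.
apply/eqP; rewrite eq_le; apply/andP; split.
  rewrite -py; apply: ge_inf; last by exists p.
  by exists 0 => _ [z _ <-]; exact: enorm_ge0.
apply: lb_le_inf; first by exists (enorm (y - p)), p.
by move=> _ [z Lz <-]; exact: lb.
Qed.

Lemma hyperplane_affine a b : a != 0 -> affine_hyperplane (hyperplane a b).
Proof. by move=> a0; exists a, b. Qed.

End Geometry.

(** * Supports, coverings, decay of affine functions *)

Section Measure.
Variables (R : realType) (n : nat).
Variable mu : {measure set (borelRV R n) -> \bar R}.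
Implicit Types (x y z a : 'rV[R]_n) (A E U W X : set 'rV[R]_n).

Definition borel A := measurable (A : set (borelRV R n)).

Lemma open_borel A : open A -> borel A.
Proof. by move=> oA; apply: sub_sigma_algebra. Qed.

Lemma closed_borel A : closed A -> borel A.
Proof.
move=> cA; rewrite /borel -[A]setCK; apply: measurableC; apply: open_borel.
exact: closed_openC.
Qed.

Lemma le_mu A B : borel A -> borel B -> A `<=` B -> (mu A <= mu B)%E.
Proof. by move=> mA mB AB; apply: le_measure => //; rewrite inE. Qed.

Lemma locally_negligible A X :
  (forall x, X x -> exists V, [/\ open V, V x & mu.-negligible (A `&` V)]) ->
  mu.-negligible (A `&` X).
Proof.
move=> h; have /choice[V hV] x : exists V, X x ->
    [/\ open V, V x & mu.-negligible (A `&` V)].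
  by have [/h[V ?]|nXx] := pselect (X x); [exists V|exists set0].
have [|f [fX Xf]] := @lindelof R n X V; first by move=> x /hV[].
pose F k : set 'rV[R]_n := if f k is Some x then A `&` V x else set0.
apply: (@negligibleS _ _ _ mu (\bigcup_k F k)) => [y [Ay Xy]|].
  by have [k [x [fk Vy]]] := Xf _ Xy; exists k => //; rewrite /F fk.
apply: negligible_bigcup => k; rewrite /F.
case fk: (f k) => [x|]; last exact: negligible_set0.
by have [] := hV x (fX _ _ fk).
Qed.

Lemma msupp_compl_negligible : mu.-negligible (~` msupp mu).
Proof.
rewrite -[~` _]setTI; apply: locally_negligible => x.
move=> /existsNP[U] /not_implyP[oU] /not_implyP[Ux /negP mU].
exists U; split => //; rewrite setTI; apply/negligibleP; first exact: open_borel.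
by apply/eqP; rewrite -measure_le0 leNgt.
Qed.

Lemma msupp_borel : borel (msupp mu).
Proof.
apply: closed_borel; rewrite -[msupp mu]setCK; apply: open_closedC.
rewrite openE => x /existsNP[U] /not_implyP[oU] /not_implyP[Ux nU].
rewrite /interior nbhsE; exists U => // y Uy /(_ U oU Uy); exact: nU.
Qed.

Lemma mu_msupp A : borel A -> mu (A `&` msupp mu) = mu A.
Proof.
move=> mA; apply/eqP; rewrite eq_le le_mu//=; last first.
  by apply: measurableI => //; exact: msupp_borel.
have [N [mN N0 sN]] := msupp_compl_negligible.
have mI : borel (A `&` msupp mu) by apply: measurableI => //; exact: msupp_borel.
rewrite -[leRHS]adde0 -N0; apply: le_trans (measureU2 _ mI mN).
apply: le_mu => //; first exact: measurableU.
move=> y Ay; have [sy|nsy] := pselect (msupp mu y); first by left.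
by right; exact: sN.
Qed.

Definition eballs (s : seq ('rV[R]_n * R)) : set 'rV[R]_n :=
  [set y | exists2 p, p \in s & eball p.1 p.2 y].

Lemma eballs_borel s : borel (eballs s).
Proof.
apply: open_borel; rewrite openE => y [p ps py].
rewrite /interior nbhsE; exists (eball p.1 p.2).
  by split => //; exact: eball_open.
by move=> z pz; exists p.
Qed.

Lemma eball_borel x e : borel (eball x e).
Proof. apply: open_borel; exact: eball_open. Qed.

Lemma max_radius (s : seq ('rV[R]_n * R)) : s != [::] ->
  exists2 p, p \in s & forall q, q \in s -> q.2 <= p.2.
Proof.
elim: s => // p [|p' s] IH _.
  by exists p; rewrite ?mem_head// => q; rewrite inE => /eqP->.
have [//|m ms mh] := IH; have [pm|mp] := leP p.2 m.2.
  exists m; first by rewrite inE ms orbT.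
  by move=> q; rewrite inE => /predU1P[->|/mh].
exists p; first by rewrite mem_head.
move=> q; rewrite inE => /predU1P[->//|/mh h]; exact: le_trans h (ltW mp).
Qed.

(* Greedy Vitali selection: discard the balls that meet a ball of maximal
   radius; they all lie in its 3-fold dilate. *)
Lemma vitali_seq E (K : R) (s : seq ('rV[R]_n * R)) : borel E -> 0 <= K ->
  (forall p, p \in s -> 0 < p.2 /\
    (mu (E `&` eball p.1 (3 * p.2)) <= K%:E * mu (eball p.1 p.2))%E) ->
  (mu (E `&` eballs s) <= K%:E * mu (eballs s))%E.
Proof.
move=> mE K0; have [m] := ubnP (size s); elim: m s => // m IH s sm hs.
have [->|s0] := eqVneq s [::].
  have -> : E `&` eballs [::] = set0 by apply/seteqP; split => // y [_ []].
  by rewrite measure0 mule_ge0.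
have [p ps maxp] := max_radius s0; have [p0 hp] := hs _ ps.
pose s' := [seq q <- s | `[< eball q.1 q.2 `&` eball p.1 p.2 = set0 >]].
have s's q : q \in s' -> q \in s by rewrite mem_filter => /andP[].
have sz : (size s' < m)%N.
  apply: leq_trans (ltnSE sm); rewrite size_filter -[X in (_ < X)%N](count_predC
    (fun q => `[< eball q.1 q.2 `&` eball p.1 p.2 = set0 >])).
  rewrite -addn1 leq_add2l -has_count; apply/hasP; exists p => //=.
  apply/asboolPn; rewrite setIid => pe0.
  by have := eball_center p.1 p0; rewrite pe0.
have IHs := IH s' sz (fun q qs => hs q (s's q qs)).
have mB : borel (E `&` eballs s') by apply: measurableI => //; exact: eballs_borel.
have mP : borel (E `&` eball p.1 (3 * p.2)).
  by apply: measurableI => //; exact: eball_borel.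
apply: (@le_trans _ _ (mu (E `&` eballs s') + mu (E `&` eball p.1 (3 * p.2)))%E).
  apply: le_trans (measureU2 _ mB mP); apply: le_mu.
  - by apply: measurableI => //; exact: eballs_borel.
  - exact: measurableU.
  move=> y [Ey [q qs qy]].
  have [qp|qp] := pselect (eball q.1 q.2 `&` eball p.1 p.2 = set0).
    by left; split => //; exists q => //; rewrite mem_filter qs andbT; apply/asboolP.
  right; split => //; move/eqP/set0P: qp => [z [qz pz]].
  rewrite /eball /= in qy qz pz *; have := maxp q qs.
  have := enorm_triangle z y p.1; have := enorm_triangle q.1 y z.
  rewrite (enormB q.1 z); lra.
apply: (le_trans (leeD IHs hp)); rewrite -ge0_muleDr//.
apply: lee_wpmul2l => //; rewrite -measureU//; first last.
- apply/seteqP; split => // y [[q]]; rewrite mem_filter => /andP[/asboolP qp _ qy py].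
  by rewrite -qp.
- exact: eball_borel.
- exact: eballs_borel.
apply: le_mu; [|exact: eballs_borel|].
  by apply: measurableU; [exact: eballs_borel|exact: eball_borel].
by move=> y [[q /s's qs qy]|py]; [exists q|exists p].
Qed.

(** By [lindelof], countably many of the balls cover [E]. Finite subfamilies are handled by
    [vitali_seq], and continuity from below gives the bound for [E]. *)
Lemma vitali_measure E W (K : R) : borel E -> borel W -> 0 <= K ->
  (forall x, E x -> exists e, [/\ 0 < e, eball x e `<=` W &
    (mu (E `&` eball x (3 * e)) <= K%:E * mu (eball x e))%E]) ->
  (mu E <= K%:E * mu W)%E.
Proof.
move=> mE mW K0 h.
have /choice[rho hrho] x : exists e, E x -> [/\ 0 < e, eball x e `<=` W &
    (mu (E `&` eball x (3 * e)) <= K%:E * mu (eball x e))%E].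
  by have [/h[e ?]|nXx] := pselect (E x); [exists e|exists 0].
have [|f [fE Ef]] := @lindelof R n E (fun x => eball x (rho x)).
  by move=> x /hrho[? _ _]; split; [exact: eball_open|exact: eball_center].
pose s m := pmap (fun k => omap (fun x => (x, rho x)) (f k)) (iota 0 m).
have sE m p : p \in s m -> E p.1 /\ p.2 = rho p.1.
  rewrite mem_pmap => /mapP[k _]; case fk: (f k) => [x|]//= -[->] /=.
  by split => //; exact: fE fk.
pose F m := E `&` eballs (s m).
have mF m : borel (F m) by apply: measurableI => //; exact: eballs_borel.
have FE : \bigcup_m F m = E.
  apply/seteqP; split => [y [m _ []]//|y Ey].
  have [k [x [fk xy]]] := Ef _ Ey; exists k.+1 => //; split => //.
  exists (x, rho x) => //; rewrite mem_pmap; apply/mapP; exists k.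
    by rewrite mem_iota add0n ltnS leqnn.
  by rewrite fk.
have ndF : {homo F : i j / (i <= j)%N >-> (i <= j)%O}.
  move=> i j ij; apply/subsetPset => y [Ey [p ps py]]; split => //; exists p => //.
  rewrite /s -(subnKC ij) iotaD; rewrite mem_pmap map_cat mem_cat -mem_pmap.
  by rewrite ps.
have := nondecreasing_cvg_mu (mu := mu) mF (bigcupT_measurable _ mF) ndF.
rewrite FE; apply: cvge_le; apply: nearW => m /=.
apply: le_trans (@vitali_seq E K (s m) mE K0 _) _.
  by move=> p /sE[/hrho[? _ ?] ->].
apply: lee_wpmul2l => //; apply: le_mu => //; first exact: eballs_borel.
by move=> y [p /sE[/hrho[_ + _] ->]]; exact.
Qed.

(** Since [x] is in the support, the small ball has positive measure; together with finiteness this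
    turns the extended-real quotient into a quotient of real numbers. *)
Lemma federer_le D U x e : federer mu D U -> msupp mu x -> 0 < e ->
  eball x (3 * e) `<=` U -> (mu (eball x (3 * e)) < +oo)%E ->
  (mu (eball x (3 * e)) <= D%:E * mu (eball x e))%E.
Proof.
move=> fed sx e0 eU fin.
have Ux : U x by apply: eU; apply: eball_center; rewrite mulr_gt0.
have := fed x e sx Ux e0 eU.
have m0 : (0 < mu (eball x e))%E.
  by apply: sx; [exact: eball_open|exact: eball_center].
have le : (mu (eball x e) <= mu (eball x (3 * e)))%E.
  apply: le_mu; [exact: eball_borel|exact: eball_borel|].
  by apply: subset_eball; rewrite subrr enorm0; lra.
have f1 : mu (eball x e) \is a fin_num.
  by rewrite ge0_fin_numE//; exact: le_lt_trans fin.
have f2 : mu (eball x (3 * e)) \is a fin_num by rewrite ge0_fin_numE.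
move: m0; rewrite -(fineK f1) -(fineK f2) lte_fin => m0.
rewrite inver gt_eqF// lte_fin lee_fin ltr_pdivrMr//; exact: ltW.
Qed.

(** For [a != 0] the function is [enorm a] times the distance to a hyperplane, and the point [y]
    makes the supremum of that distance at least [1 / enorm a], so the ratio in the decay condition
    is at most [eps]. For [a = 0] the function is a constant that is at least 1, and the set is
    empty. *)
Lemma decaying_affine C alpha U x a y (rho b eps : R) :
  decaying mu C alpha U -> 0 <= alpha -> 0 <= C ->
  msupp mu x -> 0 < rho -> eball x rho `<=` U ->
  eball x rho y -> msupp mu y -> 1 <= `|dotp a y - b| -> 0 < eps < 1 ->
  (mu (eball x rho `&` [set z | `|dotp a z - b| < eps]%R) <=
    (C * eps `^ alpha)%:E * mu (eball x rho))%E.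
Proof.
move=> dec al0 C0 sx rho0 xU xy sy aby /andP[e0 e1].
have [a0|a0] := eqVneq a 0.
  have dot0 z : dotp a z = 0 by rewrite a0 /dotp big1// => i _; rewrite mxE mul0r.
  have -> : eball x rho `&` [set z | `|dotp a z - b| < eps]%R = set0.
    apply/seteqP; split => // z [_] /=; move: aby; rewrite !dot0; lra.
  by rewrite measure0 mule_ge0// lee_fin mulr_ge0// powR_ge0.
have na : 0 < enorm a by rewrite enorm_gt0.
have := dec x rho (hyperplane a b) (eps / enorm a) sx rho0 xU
  (hyperplane_affine b a0) (divr_gt0 e0 na).
have -> : thickening (hyperplane a b) (eps / enorm a) =
    [set z | `|dotp a z - b| < eps]%R.
  apply/seteqP; split => z; rewrite /thickening /= edistance_hyperplane//;
    by rewrite ltr_pM2r// invr_gt0.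
move=> /le_trans; apply; rewrite [(C * _)%:E]EFinM; apply: lee_wpmul2r => //.
apply: lee_wpmul2l; first by rewrite lee_fin.
rewrite -poweR_EFin.
set s := supnorm _ _ _.
have s1 : (((enorm a)^-1)%:E <= s)%E.
  apply: le_ereal_sup_tmp; exists (`|edistance (hyperplane a b) y|)%:E.
    by exists y.
  rewrite lee_fin edistance_hyperplane// ger0_norm ?divr_ge0 ?enorm_ge0//.
  by rewrite -[leLHS]mul1r ler_pM2r// invr_gt0.
have s0 : (0 <= s)%E by apply: le_trans s1; rewrite lee_fin invr_ge0 enorm_ge0.
have sV : (s^-1 <= (enorm a)%:E)%E.
  rewrite inve_ple ?inE ?lee_fin ?enorm_ge0//.
  by rewrite inver gt_eqF.
apply: gt0_ler_poweR => //.
- rewrite in_itv/= leey andbT mule_ge0// ?inve_ge0// lee_fin divr_ge0//.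
    exact: ltW.
  exact: enorm_ge0.
- by rewrite in_itv/= leey andbT lee_fin ltW.
apply: le_trans (lee_wpmul2l _ sV) _.
  by rewrite lee_fin divr_ge0// ?enorm_ge0// ltW.
by rewrite -EFinM divfK ?gt_eqF.
Qed.

End Measure.

(** * Quantitative nondivergence along flags *)

Definition max_affine (R : realType) n (f : 'rV[R]_n -> R) :=
  exists (J : finType) (a : J -> 'rV[R]_n) (b : J -> R),
    forall x, f x = \big[Num.max/0]_j `|dotp (a j) x - b j|.


Lemma max_affine_continuous (R : realType) n (f : 'rV[R]_n -> R) :
  max_affine f -> continuous f.
Proof.
move=> [J [a [b fE]]].
have -> : f = fun x => \big[Num.max/0]_j `|dotp (a j) x - b j| by apply/funext.
apply: continuous_big => [|j _]; first exact: max_continuous.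
move=> x; apply: (@continuous_comp _ _ _ (fun x => dotp (a j) x - b j) Num.norm).
  apply: (@continuousB R R _ (dotp (a j)) (fun=> b j)).
    exact: dotp_continuous.
  exact: cst_continuous.
exact: norm_continuous.
Qed.

(** Some affine piece already reaches 1 at [y], and where the maximum is below [eps] so is this
    piece. *)
Lemma decaying_max_affine (R : realType) n
    (mu : {measure set (borelRV R n) -> \bar R}) (C alpha rho eps : R)
    (U : set 'rV[R]_n) (f : 'rV[R]_n -> R) (x y : 'rV[R]_n) :
  max_affine f -> decaying mu C alpha U -> 0 <= alpha -> 0 <= C ->
  msupp mu x -> 0 < rho -> eball x rho `<=` U ->
  eball x rho y -> msupp mu y -> 1 <= f y -> 0 < eps < 1 ->
  (mu (eball x rho `&` [set z | f z < eps]%R) <=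
    (C * eps `^ alpha)%:E * mu (eball x rho))%E.
Proof.
move=> fA dec al0 C0 sx rho0 xU xy sy fy e01.
have fc := max_affine_continuous fA; move: (fA) => [J [a [b fE]]].
have fop (e : R) : open [set z | f z < e].
  have -> : [set z | f z < e] = f @^-1` [set t | t < e] by [].
  by apply: open_comp => [z _|]; [exact: fc|exact: open_lt].
have [j fj] : exists j, 1 <= `|dotp (a j) y - b j|.
  apply: contrapT => /forallNP nj.
  suff : f y < 1 by rewrite ltNge fy.
  by rewrite fE; apply/bigmax_ltP; split => // j _; rewrite ltNge; apply/negP.
apply: le_trans (decaying_affine dec al0 C0 sx rho0 xU xy sy fj e01).
have mB := @eball_borel R n x rho.
apply: le_mu.
- by apply: measurableI => //; exact: open_borel.
- apply: measurableI => //; apply: open_borel.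
  have -> : [set z | `|dotp (a j) z - b j| < eps] =
    (fun z => `|dotp (a j) z - b j|) @^-1` [set t | t < eps] by [].
  apply: open_comp; last exact: open_lt.
  move=> z _; apply: (@continuous_comp _ _ _ (fun x => dotp (a j) x - b j) Num.norm).
    apply: (@continuousB R R _ (dotp (a j)) (fun=> b j)).
      exact: dotp_continuous.
    exact: cst_continuous.
  exact: norm_continuous.
move=> z [xz /= fz]; split => //=; apply: le_lt_trans fz; rewrite fE.
exact: le_bigmax.
Qed.

Section Nondivergence.
Variables (R : realType) (n : nat).
Variable mu : {measure set (borelRV R n) -> \bar R}.
Variables (U : set 'rV[R]_n) (C alpha D : R).
Hypotheses (mu_fin : (mu U < +oo)%E) (oU : open U).
Hypotheses (C_gt0 : 0 < C) (alpha_gt0 : 0 < alpha) (D_gt0 : 0 < D).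
Hypotheses (fed : federer mu D U) (dec : decaying mu C alpha U).

Variables (I : eqType) (psi : I -> 'rV[R]_n -> R) (cmp : I -> I -> Prop).
Variables (S : set 'rV[R]_n) (N : nat) (eps : R).

(** Flags in abstract form: [I] stands for the lattices and [cmp] for strict inclusion one way or
    the other. A flag is a list of pairwise comparable indices, the latest one at its head. *)
Definition compat (F : seq I) (G : I) := forall D, D \in F -> cmp D G.

Fixpoint flag (F : seq I) := if F is D :: F' then compat F' D /\ flag F' else True.

Hypothesis psiA : forall G, max_affine (psi G).
Hypothesis S_borel : borel S.
Hypothesis eps01 : 0 < eps < 1.
Hypothesis flag_size : forall F, flag F -> (size F <= N)%N.
Hypothesis chain : forall F x, flag F -> S x ->
  (forall D, D \in F -> eps <= psi D x <= 1) ->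
  exists2 G, compat F G & psi G x < 1.

(** Points off the support are excluded because the Federer and decay conditions only concern balls
    centred in it. *)
Definition bad (F : seq I) : set 'rV[R]_n :=
  [set x | [/\ S x, msupp mu x & forall D, D \in F -> eps <= psi D x <= 1]].

Lemma bad_borel F : borel (bad F).
Proof.
elim: F => [|G F IH].
  have -> : bad [::] = S `&` msupp mu.
    by apply/seteqP; split => x [Sx sx].
  by apply: measurableI => //; exact: msupp_borel.
have -> : bad (G :: F) = bad F `&`
    ([set x | eps <= psi G x] `&` [set x | psi G x <= 1]).
  apply/seteqP; split => x.
    move=> [Sx sx h]; split; last first.
      by have /andP[] := h G (mem_head _ _).
    by split => // D' D'F; apply: h; rewrite inE D'F orbT.
  move=> [[Sx sx h] [/= h1 h2]]; split => // D'; rewrite inE.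
  by move=> /predU1P[->|/h//]; rewrite h1 h2.
have pc := max_affine_continuous (psiA G).
apply: measurableI => //; apply: closed_borel; apply: closedI.
  have -> : [set x | eps <= psi G x] = psi G @^-1` [set t | eps <= t] by [].
  by apply: closed_comp => [x _|]; [exact: pc|exact: closed_ge].
have -> : [set x | psi G x <= 1] = psi G @^-1` [set t | t <= 1] by [].
by apply: closed_comp => [x _|]; [exact: pc|exact: closed_le].
Qed.

(** Each enlargement of the flag costs one factor [D] to shrink the ball about [z] from [3 * rho] to
    [rho], and two to pass from radius [2 * e] to [e / 3] about a bad point. [C] accounts for the
    points where the new function drops below [eps], the recursive term for the others. *)
Fixpoint nondiv_const k : R :=
  if k is k'.+1 then D * (D * (D * (C + nondiv_const k'))) else 0.

Lemma nondiv_const_ge0 k : 0 <= nondiv_const k.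
Proof.
elim: k => //= k IH; rewrite !mulr_ge0 ?(ltW D_gt0)//.
by rewrite addr_ge0// ltW.
Qed.

Lemma mu_eball_fin x e : eball x e `<=` U -> (mu (eball x e) < +oo)%E.
Proof.
move=> xU; apply: le_lt_trans mu_fin; apply: le_mu => //.
  exact: eball_borel.
exact: open_borel.
Qed.

(* The radius is maximal up to a factor 2 among all compatible indices at once,
   so no local finiteness of the family [psi] is needed. *)
Lemma almost_maximal_ball F z rho x : 0 < rho -> flag F ->
  (forall G, compat F G -> exists y, [/\ eball z rho y, msupp mu y & 1 <= psi G y]) ->
  bad F x -> eball z rho x ->
  exists e G, [/\ 0 < e, e < 2 * rho, compat F G,
    (forall y, eball x e y -> msupp mu y -> psi G y < 1) &
    forall G', compat F G' ->
      exists y, [/\ eball x (2 * e) y, msupp mu y & 1 <= psi G' y]].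
Proof.
move=> rho0 flF hF [Sx sx Fx] zx.
pose A := [set e : R | 0 < e /\ exists2 G, compat F G &
  forall y, eball x e y -> msupp mu y -> psi G y < 1].
have Aub e : A e -> e < 2 * rho.
  move=> [e0 [G cG hG]]; have [y [zy sy Gy]] := hF G cG; rewrite ltNge.
  apply/negP => le; suff : psi G y < 1 by rewrite ltNge Gy.
  apply: hG => //; move: zx zy; rewrite /eball /= => zx zy.
  by have := enorm_triangle z y x; rewrite (enormB z x); lra.
have [G0 cG0 G0x] := chain flF Sx Fx.
have [e0 e00 he0] : exists2 e, 0 < e & eball x e `<=` [set y | psi G0 y < 1].
  apply: open_eball => //.
  have -> : [set y | psi G0 y < 1] = psi G0 @^-1` [set t | t < 1] by [].
  apply: open_comp => [y _|]; last exact: open_lt.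
  exact: max_affine_continuous.
have Ae0 : A e0 by split => //; exists G0 => // y /he0.
have supA : has_sup A.
  by split; [exists e0|exists (2 * rho) => e /Aub/ltW].
have s0 : 0 < sup A by apply: lt_le_trans e00 _; exact: (ub_le_sup supA.2).
have s20 : 0 < sup A / 2 by rewrite divr_gt0.
(* Since [e > sup A / 2], the radius [2 * e] is not in [A]: no compatible function stays below 1 on
   the doubled ball. *)
have [e Ae es] := sup_adherent s20 supA.
have [ep [G cG hG]] := Ae; exists e, G; split => //; first exact: Aub.
move=> G' cG'; apply: contrapT => /forallNP nG'.
suff /(ub_le_sup supA.2) : A (2 * e) by lra.
split; first by rewrite mulr_gt0.
exists G' => // y xy sy; rewrite ltNge; apply/negP => Gy.
by apply: (nG' y).
Qed.

(** Induction on [k], which bounds how many indices can still be added. For [k = 0] there is no bad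
    point, as [chain] would produce a flag that is too long. The factor 7 leaves room for the balls
    about a bad point [x]: as [e < 2 * rho] and [x] is within [rho] of [z], the ball of radius
    [3 * e] about [x] stays within [7 * rho] of [z]. *)
Lemma nondivergence k F z rho : flag F -> (N <= size F + k)%N ->
  msupp mu z -> 0 < rho -> eball z (7 ^+ k.+1 * rho) `<=` U ->
  (forall G, compat F G -> exists y, [/\ eball z rho y, msupp mu y & 1 <= psi G y]) ->
  (mu (bad F `&` eball z rho) <=
    (nondiv_const k * eps `^ alpha)%:E * mu (eball z rho))%E.
Proof.
elim: k F z rho => [|k IH] F z rho flF sF sz rho0 zU hF.
  have -> : bad F `&` eball z rho = set0.
    apply/seteqP; split => // x [[Sx sx Fx] _].
    have [G cG _] := chain flF Sx Fx.
    have /flag_size/= : flag (G :: F) by split.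
    by rewrite ltnNge -[size F]addn0 sF.
  by rewrite measure0 mul0r mul0e.
set c := nondiv_const k in IH *.
have c0 : 0 <= c by exact: nondiv_const_ge0.
set p := eps `^ alpha in IH *.
have p0 : 0 <= p by exact: powR_ge0.
have sevenk : 1 <= 7 ^+ k.+1 :> R by apply: exprn_ege1; lra.
move: zU IH; rewrite exprS; move: (7 ^+ k.+1) sevenk => w w1 zU IH.
have sub7 e : e <= 7 * rho -> eball z e `<=` U.
  move=> le; apply: subset_trans zU; apply: subset_eball.
  by rewrite subrr enorm0 add0r; nra.
have mE : borel (bad F `&` eball z rho).
  by apply: measurableI; [exact: bad_borel|exact: eball_borel].
have z3 : (mu (eball z (3 * rho)) <= D%:E * mu (eball z rho))%E.
  have z3U : eball z (3 * rho) `<=` U by apply: sub7; lra.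
  by apply: (federer_le fed) => //; exact: mu_eball_fin.
apply: (@le_trans _ _ ((D * (D * (C + c)) * p)%:E * mu (eball z (3 * rho))))%E;
  last first.
  apply: le_trans (lee_wpmul2l _ z3) _.
    by rewrite lee_fin !mulr_ge0// ?(ltW D_gt0)// addr_ge0// ltW.
  rewrite muleA -EFinM /= -/c.
  by rewrite (_ : D * (D * (C + c)) * p * D = D * (D * (D * (C + c))) * p)//; ring.
apply: vitali_measure => //.
- exact: eball_borel.
- by rewrite !mulr_ge0// ?(ltW D_gt0)// addr_ge0// ltW.
move=> x [bx zx]; have [Sx sx Fx] := bx.
have [e [G [e0 e2 cG Glt Gge]]] := almost_maximal_ball rho0 flF hF bx zx.
have sub x' s : x' + enorm (x - z) <= s -> eball x x' `<=` eball z s.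
  by move=> le; apply: subset_eball; rewrite addrC.
have zx' : enorm (x - z) < rho by exact: zx.
(* The selection dilates by 3, so the estimate is needed exactly on the ball of radius [e], where
   [psi G] is below 1 on the support. *)
exists (e / 3); split; first by rewrite divr_gt0.
  by apply: sub; lra.
have -> : 3 * (e / 3) = e by field.
have flG : flag (G :: F) by split.
have x2U : eball x (2 * e) `<=` U.
  by apply: subset_trans (sub7 (7 * rho) _) => //; apply: sub; lra.
have e20 : 0 < 2 * e by rewrite mulr_gt0.
have step1 := IH (G :: F) x (2 * e) flG _ sx e20 _ _.
have {}step1 : (mu (bad (G :: F) `&` eball x (2 * e)) <=
    (c * p)%:E * mu (eball x (2 * e)))%E.
  apply: step1; first by rewrite /= addSnnS.
    by apply: subset_trans zU; apply: sub; nra.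
  by move=> G' cG'; apply: Gge => D' D'F; apply: cG'; rewrite inE D'F orbT.
have [y [xy sy Gy]] := Gge G cG.
have step2 := decaying_max_affine (psiA G) dec (ltW alpha_gt0) (ltW C_gt0) sx
  e20 x2U xy sy Gy eps01.
have mB1 : borel (bad (G :: F) `&` eball x (2 * e)).
  by apply: measurableI; [exact: bad_borel|exact: eball_borel].
have mB2 : borel (eball x (2 * e) `&` [set z | psi G z < eps]).
  apply: measurableI; first exact: eball_borel.
  apply: open_borel.
  have -> : [set y | psi G y < eps] = psi G @^-1` [set t | t < eps] by [].
  apply: open_comp => [u _|]; last exact: open_lt.
  exact: max_affine_continuous.
(* A bad point of the ball of radius [e] either has [psi G < eps], and decay applies, or has [psi G]
   in [[eps, 1]], and is bad for the longer flag. Both sets are measured on the ball of radius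
   [2 * e], where [psi G] reaches 1. *)
apply: (@le_trans _ _ (mu (bad (G :: F) `&` eball x (2 * e)) +
    mu (eball x (2 * e) `&` [set z | psi G z < eps]%R))%E).
  apply: le_trans (measureU2 _ mB1 mB2); apply: le_mu.
  - by apply: measurableI => //; exact: eball_borel.
  - exact: measurableU.
  move=> u [[[Su su Fu] zu] xu].
  have xu2 : eball x (2 * e) u.
    by move: u xu {Su su Fu zu}; apply: subset_eball; rewrite subrr enorm0; lra.
  have [lt|ge] := ltP (psi G u) eps; first by right.
  left; split => //; split => // D'; rewrite inE => /predU1P[->|/Fu//].
  by rewrite ge/= ltW// Glt.
apply: le_trans (leeD step1 step2) _.
rewrite -ge0_muleDl ?lee_fin ?mulr_ge0// ?(ltW C_gt0)//.
rewrite -EFinD.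
(* As [2 * e <= 9 * (e / 3)], the Federer condition is applied twice. *)
have e3 : (mu (eball x (2 * e)) <= (D * D)%:E * mu (eball x (e / 3)))%E.
  have sub9 : eball x (3 * (3 * (e / 3))) `<=` U.
    by apply: subset_trans (sub7 (7 * rho) _) => //; apply: sub; lra.
  have sub3 : eball x (3 * (e / 3)) `<=` U.
    by apply: subset_trans (sub7 (7 * rho) _) => //; apply: sub; lra.
  apply: (@le_trans _ _ (mu (eball x (3 * (3 * (e / 3)))))).
    apply: le_mu; [exact: eball_borel|exact: eball_borel|].
    by apply: subset_eball; rewrite subrr enorm0; lra.
  have h1 : 0 < 3 * (e / 3) by lra.
  apply: le_trans (federer_le fed sx h1 sub9 (mu_eball_fin sub9)) _.
  rewrite EFinM -muleA; apply: lee_wpmul2l; first by rewrite lee_fin ltW.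
  by apply: (federer_le fed sx _ sub3 (mu_eball_fin sub3)); lra.
apply: le_trans (lee_wpmul2l _ e3) _.
  by rewrite lee_fin addr_ge0 ?mulr_ge0// ltW.
rewrite muleA -EFinM.
by rewrite (_ : (c * p + C * p) * (D * D) = D * (D * (C + c)) * p)//; ring.
Qed.

End Nondivergence.

(** * Minors under rank-one perturbations *)

Section Minors.
Variable F : comNzRingType.

(** Columns are selected by arbitrary maps rather than increasing ones, so that [upd] can replace a
    column without reordering. *)
Definition minor m j (f : 'I_j -> 'I_m) (A : 'M[F]_(j, m)) := \det (colsub f A).

Definition upd m j (f : 'I_j -> 'I_m) k l := fun k' => if k' == k then l else f k'.

Lemma minor_ext m j (f g : 'I_j -> 'I_m) A : f =1 g -> minor f A = minor g A.
Proof. by move=> fg; congr determinant; apply/matrixP => a b; rewrite !mxE fg. Qed.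

Lemma minor_mul m j (f : 'I_j -> 'I_m) (A : 'M[F]_j) (M : 'M[F]_(j, m)) :
  minor f (A *m M) = \det A * minor f M.
Proof.
rewrite /minor -det_mulmx; congr determinant; apply/matrixP => a b.
by rewrite !mxE; apply: eq_bigr => k _; rewrite !mxE.
Qed.

Lemma minor_inj m j (f : 'I_j -> 'I_m) (A : 'M[F]_(j, m)) :
  minor f A != 0 -> injective f.
Proof.
move=> f0 k l fkl; apply/eqP; apply: contraNT f0 => kl.
rewrite /minor -det_tr; apply/eqP; apply: determinant_alternate kl _ => a.
by rewrite !mxE fkl.
Qed.

(** The block matrix with rows [(1, -Y)] and [(q, C)] has this determinant, by a column operation.
    Expanding it along the first row shows that it is affine in [Y], and taking [Y] to be a basis
    vector identifies the coefficients by multilinearity in one column. *)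
Lemma det_rank1D j (C : 'M[F]_j) (q : 'cV[F]_j) (Y : 'rV[F]_j) :
  \det (C + q *m Y) = \det C +
    \sum_k Y 0 k * \det (\matrix_(a, b) (if b == k then q a 0 else C a b)).
Proof.
pose B (Z : 'rV[F]_j) := block_mx 1%:M (- Z) q C.
have detB Z : \det (B Z) = \det (C + q *m Z).
  have <- : \det (B Z *m block_mx 1%:M Z 0 1%:M) = \det (C + q *m Z).
    rewrite mulmx_block !mulmx1 !mul1mx !mulmx0 !addr0 subrr det_lblock det1 mul1r.
    by rewrite addrC.
  by rewrite det_mulmx det_ublock !det1 !mulr1.
have cofB Z k : cofactor (B Z) 0 k = cofactor (B 0) 0 k.
  congr (_ * determinant _); apply/matrixP => a b.
  rewrite mxE [in RHS]mxE mxE [in RHS]mxE.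
  have -> : lift 0 a = rshift 1 a by apply/val_inj.
  by case: (split_ordP (lift k b)) => c ->; rewrite ?block_mxEdl ?block_mxEdr.
have expB Z : \det (B Z) = cofactor (B 0) 0 0 -
    \sum_k Z 0 k * cofactor (B 0) 0 (rshift 1 k).
  have e0 : 0 = lshift j 0 :> 'I_(1 + j) by apply/val_inj.
  have B0 : B Z 0 0 = 1 by rewrite [in LHS]e0 block_mxEul mxE.
  have Br k : B Z 0 (rshift 1 k) = - Z 0 k.
    by rewrite [X in B Z X _]e0 block_mxEur mxE.
  rewrite (expand_det_row _ 0) big_ord_recl -sumrN; congr (_ + _).
    by rewrite cofB B0 mul1r.
  apply: eq_bigr => k _; rewrite cofB -mulNr.
  have -> : lift ord0 k = rshift 1 k by apply/val_inj.
  by rewrite Br.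
have det0 : \det C = cofactor (B 0) 0 0.
  have := expB 0; rewrite detB mulmx0 addr0 => ->.
  by rewrite big1 ?subr0// => k _; rewrite mxE mul0r.
rewrite -detB expB det0; congr (_ + _); rewrite -sumrN; apply: eq_bigr => k _.
rewrite -mulrN; congr (_ * _).
have := expB (delta_mx 0 k); rewrite detB -det0.
rewrite (bigD1 k)//= big1 ?addr0 => [|l lk]; last first.
  by rewrite mxE eqxx (negbTE lk) mul0r.
rewrite mxE !eqxx mul1r => /esym/(canRL (addKr _))->.
rewrite addrC; apply/eqP; rewrite subr_eq; apply/eqP.
rewrite -det_tr -[X in _ = X + _]det_tr -[X in _ = _ + X]det_tr.
rewrite -[X in _ = X + _]mul1r -[X in _ = _ + X]mul1r.
apply: (determinant_multilinear (i0 := k)).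
- apply/rowP => a; rewrite !mxE eqxx !mul1r big_ord1 mxE !eqxx mulr1.
  by rewrite addrC.
- by apply/matrixP => a b; rewrite !mxE eq_sym (negbTE (neq_lift _ _))
    big_ord1 mxE (eq_sym _ k) (negbTE (neq_lift _ _)) andbF mulr0 addr0.
- by apply/matrixP => a b; rewrite !mxE big_ord1 mxE (eq_sym _ k)
    (negbTE (neq_lift _ _)) andbF mulr0 addr0.
Qed.

End Minors.

(** * Sublattices and their Plücker coordinates *)

Lemma row_free_col_mx (F : fieldType) j m (v : 'rV[F]_m) (M : 'M[F]_(j, m)) :
  row_free M -> ~~ (v <= M)%MS -> row_free (col_mx v M).
Proof.
move=> fM vM; rewrite -row_leq_rank.
have lt : (M < col_mx v M)%MS.
  by rewrite ltmxE col_mx_sub (negbTE vM) andbT -addsmxE addsmxSr.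
by have := rank_ltmx lt; rewrite (eqP fM).
Qed.

Lemma row_free_minor (F : fieldType) j m (M : 'M[F]_(j, m)) :
  row_free M -> exists f : 'I_j -> 'I_m, minor f M != 0.
Proof.
move=> fM; have fT : row_full M^T by rewrite /row_full mxrank_tr.
exists (fullrankfun fT); rewrite /minor -det_tr -unitfE -unitmxE.
have -> : (colsub (fullrankfun fT) M)^T = rowsub (fullrankfun fT) M^T.
  by apply/matrixP => a b; rewrite !mxE.
exact: fullrowsub_unit.
Qed.

Section Lattices.
Variables (R : realType) (n : nat).

Notation intM := (map_mx (intr : int -> R)).

Lemma minor_int j (f : 'I_j -> 'I_n.+1) (M : 'M[int]_(j, n.+1)) :
  minor f (intM M) = (minor f M)%:~R.
Proof.
by rewrite /minor -(det_map_mx intr); congr determinant; apply/matrixP => a b;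
  rewrite !mxE.
Qed.

(* Every integral lattice spanning the same real subspace has covolume at least
   that of [M]. *)
Definition primitive j (M : 'M[int]_(j, n.+1)) :=
  forall (A : 'M[R]_j) (M' : 'M[int]_(j, n.+1)),
    intM M' = A *m intM M -> \det A != 0 -> 1 <= `|\det A|.

(** A covolume substitute with values in the natural numbers, on which descent is possible. *)
Definition height j (M : 'M[int]_(j, n.+1)) : nat :=
  (\sum_(f : {ffun 'I_j -> 'I_n.+1}) `|minor f M|)%N.

Lemma heightE j (M : 'M[int]_(j, n.+1)) :
  (height M)%:R = \sum_(f : {ffun 'I_j -> 'I_n.+1}) `|minor f (intM M)|.
Proof.
rewrite /height natr_sum; apply: eq_bigr => f _.
by rewrite minor_int natr_absz intr_norm.
Qed.

(** Descent on the height: failure of primitivity gives an integral matrix [A *m M] with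
    [0 < |det A| < 1], and all minors are multiplied by [det A]. The decrease is strict because a
    free matrix has a nonzero minor. *)
Lemma exists_primitive j (M : 'M[int]_(j, n.+1)) : row_free (intM M) ->
  exists (M' : 'M[int]_(j, n.+1)) (A : 'M[R]_j),
    [/\ primitive M', \det A != 0, `|\det A| <= 1 & intM M' = A *m intM M].
Proof.
have [m] := ubnP (height M); elim: m M => // m IH M hm fM.
have [pM|] := pselect (primitive M).
  by exists M, 1%:M; rewrite det1 oner_eq0 normr1 mul1mx.
move=> /existsNP[A] /existsNP[M1] /not_implyP[M1E] /not_implyP[A0 /negP].
rewrite -ltNge => A1.
have uA : A \in unitmx by rewrite unitmxE unitfE.
have f1 : row_free (intM M1).
  rewrite -row_leq_rank M1E mxrankMfree//.
  by rewrite mxrank_unit.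
have [|M' [B [pM' B0 B1 M'E]]] := IH M1 _ f1; last first.
  exists M', (B *m A); rewrite det_mulmx mulf_neq0// normrM.
  by rewrite mulr_ile1// ?(ltW A1)// M'E M1E mulmxA.
apply: leq_trans (ltnSE hm); rewrite -(ltr_nat R) !heightE.
have -> : \sum_(f : {ffun 'I_j -> 'I_n.+1}) `|minor f (intM M1)| =
    `|\det A| * \sum_(f : {ffun 'I_j -> 'I_n.+1}) `|minor f (intM M)|.
  by rewrite mulr_sumr; apply: eq_bigr => f _; rewrite M1E minor_mul normrM.
rewrite gtr_pMl// lt_def sumr_ge0 ?andbT => [|f _]; last exact: normr_ge0.
have [f f0] := row_free_minor fM.
rewrite psumr_neq0 => [|g _]; last exact: normr_ge0.
apply/hasP; exists (finfun f); rewrite ?mem_index_enum//= normr_gt0.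
by rewrite (@minor_ext _ _ _ _ f)// => k; rewrite ffunE.
Qed.

Record lattice := Lattice {
  lrk : nat;
  lmx : 'M[int]_(lrk, n.+1);
  lfree : row_free (intM lmx);
  lprim : primitive lmx }.

HB.instance Definition _ := gen_eqMixin lattice.

Definition lcmp (D G : lattice) :=
  (intM (lmx D) < intM (lmx G))%MS \/ (intM (lmx G) < intM (lmx D))%MS.

Lemma lrkE (L : lattice) : lrk L = \rank (intM (lmx L)).
Proof. by rewrite (eqP (lfree L)). Qed.

Lemma lcmp_lrk D G : lcmp D G -> lrk D != lrk G.
Proof.
case=> /rank_ltmx lt; rewrite neq_ltn (lrkE D) (lrkE G).
  by apply/orP; left.
by apply/orP; right.
Qed.

(** Comparable lattices have distinct ranks, and the possible ranks are [0, ..., n+1]. *)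
Lemma lattice_flag_size F : flag lcmp F -> (size F <= n.+2)%N.
Proof.
move=> fl; have u : uniq [seq lrk L | L <- F].
  elim: F fl => //= L F IH [cL /IH->]; rewrite andbT.
  apply/mapP => -[G GF]; apply/eqP; rewrite eq_sym; apply: lcmp_lrk; exact: cL.
have := uniq_leq_size (s2 := iota 0 n.+2) u; rewrite size_map size_iota; apply.
move=> _ /mapP[L _ ->]; rewrite mem_iota /= add0n ltnS lrkE; exact: rank_leq_col.
Qed.

Variable s : 'I_n.+1 -> R.

(** [x] preceded by a zero at [ord0]. The form of a sum allows the exchange of sums in
    [minor_flow_affine]. *)
Definition ext (x : 'rV[R]_n) (l : 'I_n.+1) : R :=
  \sum_(i < n) x 0 i * (l == lift ord0 i)%:R.

Lemma ext0 x : ext x ord0 = 0.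
Proof. by rewrite /ext big1// => i _; rewrite (negbTE (neq_lift _ _)) mulr0. Qed.

Lemma ext_lift x i : ext x (lift ord0 i) = x 0 i.
Proof.
rewrite /ext (bigD1 i)//= eqxx mulr1 big1 ?addr0// => k ki.
by rewrite (inj_eq lift_inj) eq_sym (negbTE ki) mulr0.
Qed.

(* The matrix of [u_x g_t] acting on row vectors [(q, p)]; the coordinate
   [ord0] carries [q]. *)
Definition flow x : 'M[R]_n.+1 :=
  \matrix_(l, k) (s k * ((l == k)%:R + (l == ord0)%:R * ext x k)).

Lemma mul_flow j (M : 'M[R]_(j, n.+1)) x a k :
  (M *m flow x) a k = s k * (M a k + M a ord0 * ext x k).
Proof.
rewrite mxE.
under eq_bigr do rewrite mxE mulrCA mulrDr [in X in _ + X]mulrA.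
rewrite -mulr_sumr big_split /=; congr (_ * (_ + _)).
  rewrite (bigD1 k)//= eqxx mulr1 big1 ?addr0// => l lk.
  by rewrite (negbTE lk) mulr0.
rewrite (bigD1 ord0)//= ?eqxx mulr1 big1 ?addr0// => l lk.
by rewrite (negbTE lk) mulr0 mul0r.
Qed.

(** [u_x] adds to [M] the rank-one product of its column [ord0] with [ext x], so [det_rank1D]
    applies to the selected columns; the diagonal part only contributes the factor in front. *)
Lemma minor_flow j (f : 'I_j -> 'I_n.+1) (M : 'M[R]_(j, n.+1)) x :
  minor f (M *m flow x) = (\prod_k s (f k)) *
    (minor f M + \sum_k ext x (f k) * minor (upd f k ord0) M).
Proof.
have -> : minor f (M *m flow x) =
    \det ((colsub f M + col ord0 M *m \row_k ext x (f k)) *m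
      diag_mx (\row_k s (f k))).
  congr determinant; apply/matrixP => a b.
  by rewrite [LHS]mxE mul_flow mul_mx_diag !mxE big_ord1 !mxE mulrC.
rewrite det_mulmx det_diag det_rank1D mulrC; congr (_ * _).
  by apply: eq_bigr => k _; rewrite mxE.
congr (_ + _); apply: eq_bigr => k _; rewrite mxE; congr (_ * determinant _).
by apply/matrixP => a b; rewrite !mxE /upd; case: eqP.
Qed.

(* The sup norm of the Plücker coordinates of [M u_x g_t], a stand-in for the
   covolume; non-injective [f] contribute zero. *)
Definition lpsi j (M : 'M[int]_(j, n.+1)) x : R :=
  \big[Num.max/0]_(f : {ffun 'I_j -> 'I_n.+1}) `|minor f (intM M *m flow x)|.

Lemma minor_le_lpsi j (f : 'I_j -> 'I_n.+1) M x :
  `|minor f (intM M *m flow x)| <= lpsi M x.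
Proof.
rewrite (@minor_ext _ _ _ _ (finfun f)); last by move=> k; rewrite ffunE.
exact: (le_bigmax _ (fun f : {ffun _ -> _} => `|minor f (intM M *m flow x)|)).
Qed.

Lemma lpsi_le j (M : 'M[int]_(j, n.+1)) x e : 0 <= e ->
  (forall f : 'I_j -> 'I_n.+1, `|minor f (intM M *m flow x)| <= e) ->
  lpsi M x <= e.
Proof. by move=> e0 h; apply/bigmax_leP; split => // f _; exact: h. Qed.

Lemma lpsi_ge0 j (M : 'M[int]_(j, n.+1)) x : 0 <= lpsi M x.
Proof. exact: bigmax_ge_id. Qed.

Definition flow_coef j (f : 'I_j -> 'I_n.+1) (M : 'M[R]_(j, n.+1)) : 'rV[R]_n :=
  \row_i \sum_k (f k == lift ord0 i)%:R * minor (upd f k ord0) M.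

Lemma minor_flow_affine j (f : 'I_j -> 'I_n.+1) (M : 'M[R]_(j, n.+1)) x :
  minor f (M *m flow x) =
    (\prod_k s (f k)) * (dotp (flow_coef f M) x - (- minor f M)).
Proof.
rewrite minor_flow opprK addrC; congr (_ * (_ + _)).
rewrite /dotp; under eq_bigr do rewrite mulr_suml.
under [RHS]eq_bigr do rewrite mxE mulr_suml.
rewrite [RHS]exchange_big /=; apply: eq_bigr => k _; apply: eq_bigr => i _.
by rewrite -mulrA mulrC.
Qed.

Lemma lpsi_max_affine j (M : 'M[int]_(j, n.+1)) : max_affine (lpsi M).
Proof.
exists {ffun 'I_j -> 'I_n.+1},
  (fun f : {ffun _ -> _} => (\prod_k s (f k)) *: flow_coef f (intM M)),
  (fun f : {ffun _ -> _} => - ((\prod_k s (f k)) * minor f (intM M))) => x.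
apply: eq_bigr => f _; congr `|_|; rewrite minor_flow_affine.
by rewrite [in RHS]dotpC dotpZr [in RHS]dotpC !opprK mulrDr.
Qed.

(** The spans agree, so [M'] is [A *m M] with [A] invertible. All minors are multiplied by [det A],
    of absolute value at least 1 by primitivity. *)
Lemma primitive_lpsi_le j j' (M : 'M[int]_(j, n.+1)) (M' : 'M[int]_(j', n.+1)) x :
  row_free (intM M) -> primitive M -> row_free (intM M') ->
  (intM M <= intM M')%MS -> (intM M' <= intM M)%MS -> lpsi M x <= lpsi M' x.
Proof.
move=> fM pM fM' le1 le2; have e : j' = j.
  have := mxrankS le1; have := mxrankS le2; rewrite (eqP fM) (eqP fM') => h1 h2.
  by apply/eqP; rewrite eqn_leq h1.
subst j'; have /submxP[A M'E] := le2.
have A0 : \det A != 0.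
  rewrite -unitfE -unitmxE -row_free_unit -row_leq_rank.
  by rewrite -{1}(eqP fM') M'E mxrankM_maxl.
have A1 := pM A M' M'E A0.
apply: lpsi_le => [|f]; first exact: lpsi_ge0.
apply: le_trans (minor_le_lpsi f M' x).
by rewrite M'E -mulmxA [X in _ <= `|X|]minor_mul normrM ler_peMl.
Qed.

Lemma exists_lattice j (M : 'M[int]_(j, n.+1)) x : row_free (intM M) ->
  exists L : lattice, [/\ (intM (lmx L) <= intM M)%MS,
    (intM M <= intM (lmx L))%MS & lpsi (lmx L) x <= lpsi M x].
Proof.
move=> fM; have [M' [A [pM' A0 A1 M'E]]] := exists_primitive fM.
have uA : A \in unitmx by rewrite unitmxE unitfE.
have fM' : row_free (intM M').
  by rewrite -row_leq_rank M'E mxrankMfree// mxrank_unit.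
exists (Lattice fM' pM'); split => /=.
- by rewrite M'E submxMl.
- by rewrite M'E eqmxMfull ?row_full_unit.
apply: lpsi_le => [|f]; first exact: lpsi_ge0.
apply: le_trans (minor_le_lpsi f M x).
by rewrite M'E -mulmxA [X in `|X| <= _]minor_mul normrM ler_piMl.
Qed.

(** Laplace expansion of each minor along the row of [v]: there are [j + 1] terms, each an entry of
    size at most [eta] times a minor of [M]. *)
Lemma lpsi_col_mx j (v : 'rV[int]_n.+1) (M : 'M[int]_(j, n.+1)) x eta :
  (forall k, `|(intM v *m flow x) 0 k| <= eta) ->
  lpsi (col_mx v M) x <= j.+1%:R * eta * lpsi M x.
Proof.
move=> hv; have eta0 : 0 <= eta := le_trans (normr_ge0 _) (hv ord0).
have l0 := lpsi_ge0 M x.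
apply: lpsi_le => [|f]; first by rewrite !mulr_ge0.
rewrite /minor (expand_det_row _ 0); apply: le_trans (ler_norm_sum _ _ _) _.
rewrite -mulrA mulr_natl -[X in _ *+ X](card_ord (1 + j)) -sumr_const.
apply: ler_sum => k _; rewrite normrM map_col_mx mul_col_mx.
apply: ler_pM => //.
  have -> : 0 = lshift j 0 :> 'I_(1 + j) by apply/val_inj.
  by rewrite mxE col_mxEu.
rewrite /cofactor normrM normrX normrN1 expr1n mul1r.
apply: le_trans (minor_le_lpsi (fun b => f (lift k b)) M x).
rewrite le_eqVlt; apply/orP; left; apply/eqP; congr `|determinant _|.
apply/matrixP => a b; rewrite [LHS]mxE [LHS]mxE [LHS]mxE [RHS]mxE.
have -> : lift 0 a = rshift 1 a by apply/val_inj.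
by rewrite col_mxEd.
Qed.

(* A maximal lattice of the flag avoiding [v], to be enlarged by [v]. *)
Lemma flag_gap F (v : 'rV[int]_n.+1) x : flag lcmp F ->
  (forall D, D \in F -> lpsi (lmx D) x <= 1) -> v != 0 ->
  exists j (M : 'M[int]_(j, n.+1)), [/\ row_free (intM M), lpsi M x <= 1,
    ~~ (intM v <= intM M)%MS &
    forall D, D \in F -> if (intM v <= intM (lmx D))%MS
      then (intM M <= intM (lmx D))%MS else (intM (lmx D) <= intM M)%MS].
Proof.
move=> fl h v0.
(* The induction also records that [M] is either empty or spans the same space as a member of the
   flag, which makes it comparable with the next member. *)
suff : exists j (M : 'M[int]_(j, n.+1)), [/\ row_free (intM M), lpsi M x <= 1,
    ~~ (intM v <= intM M)%MS,
    forall D, D \in F -> if (intM v <= intM (lmx D))%MS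
      then (intM M <= intM (lmx D))%MS else (intM (lmx D) <= intM M)%MS &
    j = 0%N \/ exists2 D, D \in F & (intM M :=: intM (lmx D))%MS].
  by move=> [j [M [? ? ? ? _]]]; exists j, M.
elim: F fl h => [_ _|D F IH /= [cD fl] h].
  exists 0%N, 0; split => //.
  - by rewrite -row_leq_rank.
  - by apply: lpsi_le => // f; rewrite /minor det_mx00 normr1.
  - apply: contra v0 => /submxP[A]; rewrite map_mx0 mulmx0 => e.
    apply/eqP/rowP => k; have /rowP/(_ k) := e.
    by rewrite !mxE => /eqP; rewrite intr_eq0 => /eqP.
  - by left.
have [|j [M [fM M1 vM hM jM]]] := IH fl.
  by move=> D' D'F; apply: h; rewrite inE D'F orbT.
have MD : (intM M <= intM (lmx D))%MS \/ (intM (lmx D) <= intM M)%MS.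
  case: jM => [j0|[D' D'F eM]].
    subst j; left; rewrite (_ : intM M = 0) ?sub0mx//.
    by apply/matrixP => -[].
  have := cD D' D'F; rewrite /lcmp !eM => -[/ltmxW|/ltmxW] le; first by left.
  by right.
have [vD|vD] := boolP (intM v <= intM (lmx D))%MS.
  exists j, M; split => //.
  - move=> D'; rewrite inE => /predU1P[->|/hM//]; rewrite vD.
    case: MD => // DM; by rewrite (submx_trans vD DM) in vM.
  - by case: jM => [?|[D' D'F eM]]; [left|right; exists D'; rewrite ?inE ?D'F ?orbT].
case: MD => [MD|DM]; last first.
  exists j, M; split => //.
  - by move=> D'; rewrite inE => /predU1P[->|/hM//]; rewrite (negbTE vD).
  - by case: jM => [?|[D' D'F eM]]; [left|right; exists D'; rewrite ?inE ?D'F ?orbT].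
exists (lrk D), (lmx D); split => //.
- exact: lfree.
- by apply: h; rewrite mem_head.
- move=> D'; rewrite inE => /predU1P[->|D'F]; first by rewrite (negbTE vD) submx_refl.
  have := hM D' D'F; case: ifPn => vD' le; last exact: submx_trans le MD.
  have [lt|/ltmxW//] := cD D' D'F.
  by rewrite (submx_trans vD' (ltmxW lt)) in vD.
- by right; exists D; rewrite ?mem_head.
Qed.

(** [M] from [flag_gap] is enlarged by [v] and replaced by a primitive lattice [L] with the same
    span. Members not containing [v] lie in [M], hence strictly in [L]. A member [D] containing [v]
    contains [L]; equal spans would give [D] a value below [eps] by [primitive_lpsi_le]. *)
Lemma short_vector_chain (eta eps : R) F (v : 'rV[int]_n.+1) x :
  flag lcmp F -> eps < 1 -> n.+2%:R * eta < eps -> v != 0 ->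
  (forall k, `|(intM v *m flow x) 0 k| <= eta) ->
  (forall D, D \in F -> eps <= lpsi (lmx D) x <= 1) ->
  exists2 G, compat lcmp F G & lpsi (lmx G) x < 1.
Proof.
move=> fl e1 etae v0 hv h.
have eta0 : 0 <= eta := le_trans (normr_ge0 _) (hv ord0).
have h1 D : D \in F -> lpsi (lmx D) x <= 1 by move=> /h/andP[].
have [j [M [fM M1 vM hM]]] := flag_gap fl h1 v0.
have fvM : row_free (intM (col_mx v M)) by rewrite map_col_mx row_free_col_mx.
have [L [L1 L2 psiL]] := exists_lattice x fvM.
have jn : (j <= n.+1)%N by rewrite -(eqP fM) rank_leq_col.
have lt : lpsi (col_mx v M) x < eps.
  apply: le_lt_trans etae; apply: le_trans (lpsi_col_mx M hv) _.
  apply: (@le_trans _ _ (j.+1%:R * eta)); first by rewrite ler_piMr// mulr_ge0.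
  by rewrite ler_wpM2r// ler_nat.
exists L; last by apply: le_lt_trans psiL _; exact: lt_trans e1.
move=> D DF; have := hM D DF; have /andP[hD _] := h D DF.
have vL : (intM v <= intM (lmx L))%MS.
  by apply: submx_trans L2; rewrite map_col_mx -addsmxE addsmxSl.
have ML : (intM M <= intM (lmx L))%MS.
  by apply: submx_trans L2; rewrite map_col_mx -addsmxE addsmxSr.
case: ifPn => vD le.
  have LD : (intM (lmx L) <= intM (lmx D))%MS.
    by apply: submx_trans L1 _; rewrite map_col_mx col_mx_sub vD.
  right; rewrite ltmxE LD /=; apply/negP => DL.
  suff : lpsi (lmx D) x < eps by rewrite ltNge hD.
  apply: le_lt_trans lt; apply: primitive_lpsi_le => //.
  - exact: lfree.
  - exact: lprim.
  - exact: submx_trans DL L1.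
  - exact: submx_trans L2 LD.
left; rewrite ltmxE (submx_trans le ML) /=; apply: contra vD.
exact: submx_trans vL.
Qed.

Hypothesis s_prod : \prod_k s k = 1.
Variables (w c : R) (P : set 'rV[R]_n).
Hypothesis w_ge1 : 1 <= w.
Hypothesis s_ge : forall i : 'I_n, w <= s (lift ord0 i).
Hypothesis c_gt0 : 0 < c.
Hypothesis wc_ge1 : 1 <= w * c.
Hypothesis Paff : forall (a : 'rV[R]_n) (b : R), 1 <= `|b| \/ (exists i, 1 <= `|a 0 i|) ->
  exists2 y, P y & c <= `|dotp a y - b|.

Lemma norm_intr_ge1 (z : int) : (z%:~R : R) != 0 -> 1 <= `|z%:~R : R|.
Proof.
rewrite intr_eq0 -intr_norm => z0; apply: (@le_trans _ _ 1%:~R) => //.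
rewrite ler_int.
by rewrite -gtz0_ge1 normr_gt0.
Qed.

(** As [f] avoids [ord0], the product of the [s (f k)] is at least [w], which makes up for the
    constant [c] in [Paff]. *)
Lemma lpsi_ge1_of_coef j (M : 'M[int]_(j, n.+1)) (f : 'I_j -> 'I_n.+1) :
  (0 < j)%N -> (forall k, f k != ord0) ->
  1 <= `|minor f (intM M)| \/ (exists i, 1 <= `|flow_coef f (intM M) 0 i|) ->
  exists2 y, P y & 1 <= lpsi M y.
Proof.
move=> j0 f0 h; have [|y Py hy] := @Paff (flow_coef f (intM M)) (- minor f (intM M)).
  by rewrite normrN.
exists y => //; apply: le_trans (minor_le_lpsi f M y).
rewrite minor_flow_affine normrM.
have sw k : w <= s (f k).
  have := f0 k; rewrite eq_sym => /unlift_some[i -> _]; exact: s_ge.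
have pw : w <= \prod_k s (f k).
  rewrite (bigD1 (Ordinal j0))//= -[leLHS]mulr1; apply: ler_pM => //.
  - exact: le_trans w_ge1.
  - elim/big_ind: _ => // [a b a1 b1|k _]; first by rewrite mulr_ege1.
    exact: le_trans (sw k).
have p0 : 0 <= \prod_k s (f k) by apply: le_trans pw; exact: le_trans w_ge1.
rewrite (ger0_norm p0); apply: le_trans wc_ge1 _; apply: ler_pM => //.
- exact: le_trans w_ge1.
- exact: ltW.
Qed.

Lemma lpsi_ge1_const j (M : 'M[int]_(j, n.+1)) (f : 'I_j -> 'I_n.+1) x :
  \prod_k s (f k) = 1 ->
  (forall k, ext x (f k) * minor (upd f k ord0) (intM M) = 0) ->
  minor f (intM M) != 0 -> 1 <= lpsi M x.
Proof.
move=> p1 h f0; apply: le_trans (minor_le_lpsi f M x).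
rewrite minor_flow p1 mul1r big1 => [|k _]; last exact: h.
by rewrite addr0 minor_int norm_intr_ge1// -minor_int.
Qed.

Lemma lpsi_ge1 (L : lattice) : exists2 y, P y & 1 <= lpsi (lmx L) y.
Proof.
case: L => j M fM pM /=; have [f f0] := row_free_minor fM.
have [|y0 Py0 _] := @Paff 0 1; first by left; rewrite normr1.
have jn : (j <= n.+1)%N by rewrite -(eqP fM) rank_leq_col.
have fI := minor_inj f0.
have mf1 : 1 <= `|minor f (intM M)| by rewrite minor_int norm_intr_ge1// -minor_int.
have [j0|j0] := posnP j.
  subst j; exists y0 => //; apply: (@lpsi_ge1_const _ _ f) => //; last by case.
  by rewrite big_ord0.
move: jn; rewrite leq_eqVlt => /predU1P[jn|jn].
  subst j; exists y0 => //; have fB := injF_bij fI.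
  apply: (@lpsi_ge1_const _ _ f) => //.
    by apply: etrans s_prod; rewrite [RHS](reindex f)//; exact: onW_bij.
  (* [f] is a bijection, so putting [ord0] in place of another column repeats it and kills the
     minor. *)
  move=> k; have [->|fk] := eqVneq (f k) ord0; first by rewrite ext0 mul0r.
  have [g fg gf] := fB.
  rewrite [X in _ * X](_ : _ = 0) ?mulr0//; apply/eqP; apply: contraT => /minor_inj.
  move=> /(_ k (g ord0)); rewrite /upd eqxx.
  by case: eqP => [e|_]; [rewrite -e gf eqxx in fk|rewrite gf => /(_ erefl) e;
    rewrite e gf eqxx in fk].
have [/existsP[k0 /eqP fk0]|] := boolP [exists k, f k == ord0]; last first.
  move=> /existsPn f0'; apply: (@lpsi_ge1_of_coef _ _ f) => //; by left.
have [l lf] : exists l, l \notin codom f.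
  apply/existsP; rewrite -negb_forall; apply/negP => /forallP h.
  have e : codom f =i predT by move=> l; rewrite h.
  by have := card_codom fI; rewrite (eq_card e) !card_ord => nj; rewrite nj ltnn in jn.
have l0 : ord0 != l.
  by apply: contraNneq lf => <-; rewrite -fk0 codom_f.
have [i li _] := unlift_some l0.
apply: (@lpsi_ge1_of_coef _ _ (upd f k0 l)) => //.
  move=> k; rewrite /upd; have [_|kk0] := eqVneq k k0; first by rewrite eq_sym.
  by apply: contra kk0 => /eqP; rewrite -fk0 => /fI->.
right; exists i; rewrite mxE (bigD1 k0)//= big1 => [|k kk0]; last first.
  rewrite /upd (negbTE kk0) -li (_ : f k == l = false) ?mul0r//.
  by apply: contraNF lf => /eqP<-; rewrite codom_f.
rewrite addr0 {1}/upd eqxx li eqxx mul1r.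
rewrite (@minor_ext _ _ _ _ f)// => k; rewrite /upd.
by case: eqP => // ->.
Qed.

End Lattices.

(** * Affine functions on the support *)

Section Span.
Variables (R : realType) (n : nat).
Variables (mu : {measure set (borelRV R n) -> \bar R}).
Hypothesis mu_nonplanar : nonplanar mu.

(** The vector [(-1, y)]: its pairing with [(b, a)] is [a.y - b]. *)
Definition lifted (y : 'rV[R]_n) : 'rV[R]_n.+1 :=
  \row_l (if unlift ord0 l is Some i then y 0 i else -1).

Lemma lifted_mul y (w : 'cV[R]_n.+1) :
  (lifted y *m w) 0 0 = dotp (\row_i w (lift ord0 i) 0) y - w ord0 0.
Proof.
rewrite mxE big_ord_recl mxE unlift_none mulN1r addrC; congr (_ - _).
by apply: eq_bigr => i _; rewrite !mxE liftK mulrC.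
Qed.

Variables (z : 'rV[R]_n) (rho : R).
Hypotheses (sz : msupp mu z) (rho_gt0 : 0 < rho).

Let P := eball z rho `&` msupp mu.

(** Otherwise [a.y = b] on the support in the ball. If [a = 0] this forces [b = 0]; if not, the
    positive mass of the ball would lie on a hyperplane. *)
Lemma lifted_nonzero (w : 'cV[R]_n.+1) : w != 0 ->
  exists2 y, P y & (lifted y *m w) 0 0 != 0.
Proof.
move=> w0; pose a : 'rV[R]_n := \row_i w (lift ord0 i) 0.
apply: contrapT => nP; have {}nP y : P y -> dotp a y = w ord0 0.
  move=> Py; apply/eqP; rewrite -subr_eq0 -lifted_mul; apply: contrapT => /negP h.
  by apply: nP; exists y.
have [a0|a0] := eqVneq a 0.
  case/eqP: w0; apply/colP => l; rewrite mxE.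
  have Pz : P z by split => //; exact: eball_center.
  case: (unliftP ord0 l) => [i ->|->]; last first.
    by rewrite -(nP z Pz) a0 /dotp big1// => i _; rewrite mxE mul0r.
  by have /rowP/(_ i) := a0; rewrite !mxE.
have L0 := mu_nonplanar (hyperplane_affine (w ord0 0) a0).
have mL : borel (hyperplane a (w ord0 0)).
  apply: closed_borel.
  have -> : hyperplane a (w ord0 0) = dotp a @^-1` [set t | t = w ord0 0] by [].
  by apply: closed_comp => [x _|]; [exact: dotp_continuous|exact: closed_eq].
have mB := @eball_borel R n z rho.
have : (0 < mu (eball z rho))%E.
  by apply: sz; [exact: eball_open|exact: eball_center].
rewrite ltNge -mu_msupp// -[X in (_ <= X)%E]L0 => /negP; apply; apply: le_mu => //.
by apply: measurableI => //; exact: msupp_borel.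
Qed.

Lemma lifted_free k : (k <= n.+1)%N ->
  exists2 Y : 'M[R]_(k, n.+1), row_free Y & forall i, exists2 y, P y & row i Y = lifted y.
Proof.
elim: k => [_|k IH kn].
  by exists 0 => [|[]//]; rewrite -row_leq_rank.
have [Y fY hY] := IH (ltnW kn).
have [l wl] : exists l, col l (cokermx Y) != 0.
  apply/existsP; rewrite -negb_forall; apply/negP => /forallP h.
  have : cokermx Y == 0.
    apply/eqP/matrixP => i l; rewrite mxE; have /eqP/colP/(_ i) := h l.
    by rewrite !mxE.
  by rewrite -mxrank_eq0 mxrank_coker (eqP fY) subn_eq0 leqNgt kn.
have [y Py yw] := lifted_nonzero wl.
exists (col_mx (lifted y) Y).
  apply: row_free_col_mx => //; apply: contra yw => /submxP[A ->].
  by rewrite colE -mulmxA (mulmxA Y) mulmx_coker mul0mx mulmx0 mxE.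
move=> i; case: (split_ordP (i : 'I_(1 + k))) => [i1 ->|i1 ->]; last first.
  have [y1 Py1 Yy1] := hY i1; exists y1 => //; rewrite -Yy1.
  by apply/rowP => l'; rewrite [LHS]mxE [RHS]mxE; exact: col_mxEd.
by exists y => //; apply/rowP => l'; rewrite [LHS]mxE (ord1 i1); exact: col_mxEu.
Qed.

(** On [n + 1] points of the support with independent lifts, the values of an affine function
    determine its coefficients through [invmx Y], so small values would make all coefficients
    smaller than 1. *)
Lemma affine_lower_bound : exists2 c, 0 < c &
  forall (a : 'rV[R]_n) (b : R), 1 <= `|b| \/ (exists i, 1 <= `|a 0 i|) ->
  exists2 y, P y & c <= `|dotp a y - b|.
Proof.
have [Y fY hY] := lifted_free (leqnn _).
have uY : Y \in unitmx by rewrite -row_free_unit.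
pose K := \sum_l \sum_k `|invmx Y l k|.
have K0 : 0 <= K by apply: sumr_ge0 => l _; apply: sumr_ge0.
have K1 : 0 < K + 1 by rewrite ltr_wpDl.
have c0 : 0 < (K + 1)^-1 by rewrite invr_gt0.
exists (K + 1)^-1 => // a b hab.
pose w : 'cV[R]_n.+1 := \col_l (if unlift ord0 l is Some i then a 0 i else b).
have aE : \row_i w (lift ord0 i) 0 = a by apply/rowP => i; rewrite !mxE liftK.
have bE : w ord0 0 = b by rewrite mxE unlift_none.
have [l hl] : exists l, 1 <= `|w l 0|.
  case: hab => [hb|[i hi]]; first by exists ord0; rewrite bE.
  by exists (lift ord0 i); rewrite mxE liftK.
apply: contrapT => nP; suff : `|w l 0| < 1 by rewrite ltNge hl.
have small k : `|(Y *m w) k 0| <= (K + 1)^-1.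
  have [y Py Yy] := hY k; have -> : (Y *m w) k 0 = dotp a y - b.
    by rewrite -aE -bE -lifted_mul -Yy -row_mul [RHS]mxE.
  by rewrite leNgt; apply/negP => /ltW h; apply: nP; exists y.
rewrite -(mulKmx uY w) mxE; apply: le_lt_trans (ler_norm_sum _ _ _) _.
apply: (@le_lt_trans _ _ (\sum_k `|invmx Y l k| * (K + 1)^-1)).
  by apply: ler_sum => k _; rewrite normrM ler_wpM2l.
rewrite -mulr_suml ltr_pdivrMr// mul1r.
apply: (@le_lt_trans _ _ K); last by rewrite ltrDl.
rewrite [leRHS](bigD1 l)//= lerDl; apply: sumr_ge0 => l' _; exact: sumr_ge0.
Qed.

End Span.

(** * The weighted approximation sets *)

Lemma dotp_delta (R : realType) n (i : 'I_n) (x : 'rV[R]_n) :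
  dotp (delta_mx 0 i) x = x 0 i.
Proof.
rewrite /dotp (bigD1 i)//= mxE !eqxx mul1r big1 ?addr0// => k ki.
by rewrite mxE (negbTE ki) mul0r.
Qed.

Section Approximation.
Variables (R : realType) (n : nat) (r : 'I_n -> R).
Hypothesis r_gt0 : forall i, 0 < r i.
Hypothesis r_sum : \sum_(i < n) r i = 1.

(** The diagonal of [g_t], unimodular because the weights sum to 1. *)
Definition scaling (t : R) (l : 'I_n.+1) : R :=
  if unlift ord0 l is Some i then t `^ r i else t^-1.

Lemma scaling_prod t : 0 < t -> \prod_l scaling t l = 1.
Proof.
move=> t0; rewrite big_ord_recl /scaling unlift_none.
under eq_bigr do rewrite liftK.
suff -> : \prod_(i < n) t `^ r i = t by rewrite mulVf// gt_eqF.
rewrite -[RHS]powRr1 ?(ltW t0)// -r_sum.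
elim/big_rec2: _ => [|i x y _ ->]; first by rewrite powRr0.
by rewrite powRD ?(gt_eqF t0) ?implybT.
Qed.

Lemma exists_min_exponent : exists2 m, 0 < m & forall i, m <= r i.
Proof.
exists (\big[Num.min/1]_i r i); last by move=> i; exact: bigmin_le.
by apply: lt_bigmin => // i _; exact: r_gt0.
Qed.

Lemma wnorm_lt (x : 'rV[R]_n) e : 0 < e ->
  (wnorm r x < e) <-> (forall i, `|x 0 i| < e `^ r i).
Proof.
move=> e0; have key i : (`|x 0 i| `^ (r i)^-1 < e) = (`|x 0 i| < e `^ r i).
  have ri := r_gt0 i; have riN : 0 < (r i)^-1 by rewrite invr_gt0.
  apply/idP/idP => h.
    rewrite -[ltLHS]powRr1// -(@mulVf _ (r i)) ?gt_eqF// powRrM.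
    by apply: gt0_ltr_powR => //; rewrite nnegrE ?powR_ge0// ltW.
  rewrite -[ltRHS]powRr1 ?(ltW e0)// -(@mulfV _ (r i)) ?gt_eqF// powRrM.
  by apply: gt0_ltr_powR => //; rewrite nnegrE ?powR_ge0.
split=> [/bigmax_ltP[_ h] i|h]; first by rewrite -key; exact: h.
by apply/bigmax_ltP; split => // i _; rewrite key.
Qed.

Definition approx (t delta : R) : set 'rV[R]_n :=
  [set x | exists (p : 'rV[int]_n) (q : nat),
    [/\ (0 < q)%N, wnorm r (q%:R *: x - map_mx intr p) < delta / t &
      q%:R < delta * t]].

Lemma approx_open t delta : 0 < t -> 0 < delta -> open (approx t delta).
Proof.
move=> t0 d0; have e0 : 0 < delta / t by rewrite divr_gt0.
rewrite openE => x [p [q [q0 pq qd]]].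
rewrite /interior nbhsE.
exists [set y | wnorm r (q%:R *: y - map_mx intr p) < delta / t]; last first.
  by move=> y hy; exists p, q.
split => //=.
pose f (y : 'rV[R]_n) := \big[Num.max/0]_(i < n)
  `|dotp (((delta / t) `^ r i)^-1 *: (q%:R *: delta_mx 0 i)) y -
    ((delta / t) `^ r i)^-1 * (p 0 i)%:~R|.
have fA : max_affine f by eexists _, _, _ => y; reflexivity.
have -> : [set y | wnorm r (q%:R *: y - map_mx intr p) < delta / t] =
    f @^-1` [set u | u < 1].
  have key u i : (`|((delta / t) `^ r i)^-1 * u| < 1) = (`|u| < (delta / t) `^ r i).
    have ei : 0 < (delta / t) `^ r i by rewrite powR_gt0.
    by rewrite normrM gtr0_norm ?invr_gt0// mulrC ltr_pdivrMr// mul1r.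
  have fE y i : dotp (((delta / t) `^ r i)^-1 *: (q%:R *: delta_mx 0 i)) y -
      ((delta / t) `^ r i)^-1 * (p 0 i)%:~R =
      ((delta / t) `^ r i)^-1 * (q%:R *: y - map_mx intr p) 0 i.
    by rewrite !mxE dotpC dotpZr dotpZr dotpC dotp_delta -mulrBr.
  apply/seteqP; split => y /=; rewrite wnorm_lt//.
    by move=> h; apply/bigmax_ltP; split => // i _; rewrite fE key.
  by move=> /bigmax_ltP[_ h] i; rewrite -key -fE; exact: h.
apply: open_comp => [y _|]; last exact: open_lt.
exact: max_affine_continuous.
Qed.

(** The vector is [(q, -p)]: the flow sends it to [q / t < delta] and to coordinates [t]^ r i * (q
    x_i - p_i)[, of size below]delta [^ r i]. *)
Lemma approx_short_vector t delta eta x : 0 < t -> 0 < delta -> delta <= eta ->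
  (forall i, delta `^ r i <= eta) -> approx t delta x ->
  exists2 v : 'rV[int]_n.+1, v != 0 &
    forall k, `|(map_mx intr v *m flow (scaling t) x) 0 k| <= eta.
Proof.
move=> t0 d0 de dre [p [q [q0 pq qd]]].
exists (\row_l (if unlift ord0 l is Some i then - p 0 i else q%:Z)).
  apply/eqP => /rowP/(_ ord0); rewrite !mxE unlift_none => -[qe].
  by rewrite qe in q0.
move=> k; rewrite mul_flow !mxE unlift_none.
case: (unliftP ord0 k) => [i ->|->].
  rewrite ext_lift /scaling liftK normrM ger0_norm ?powR_ge0//.
  have := (wnorm_lt (q%:R *: x - map_mx intr p) (divr_gt0 d0 t0)).1 pq i.
  rewrite !mxE => h; apply: le_trans (dre i).
  have -> : delta `^ r i = t `^ r i * (delta / t) `^ r i.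
    rewrite -powRM ?(ltW t0) ?divr_ge0 ?(ltW d0) ?(ltW t0)//.
    by rewrite mulrCA divff ?mulr1// gt_eqF.
  rewrite ler_wpM2l ?powR_ge0//; apply: le_trans (ltW h).
  by rewrite rmorphN /= addrC.
rewrite ext0 mulr0 addr0 /scaling unlift_none.
rewrite ger0_norm ?mulr_ge0 ?invr_ge0 ?(ltW t0)//.
by apply: le_trans de; rewrite mulrC ler_pdivrMr//; exact: ltW.
Qed.

Lemma pow2_bounds (t : R) : 1 <= t -> exists k, 2 ^+ k <= t < 2 ^+ k.+1.
Proof.
move=> t1; have t0 : 0 <= t by apply: le_trans t1.
have u0 : (0 < Num.truncn t)%N by rewrite truncn_ge_nat.
have := trunc_log_bounds (isT : (1 < 2)%N) u0 => /=.
move: (trunc_log 2 _) => k /andP[k1 k2]; exists k.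
rewrite -!natrX; apply/andP; split.
  by rewrite -truncn_ge_nat.
by apply: lt_le_trans (truncnS_gt t) _; rewrite ler_nat.
Qed.

Variables (T : set R).
Hypothesis T_ge1 : forall t, T t -> 1 <= t.

Definition dyadic_part k : set R := [set t | T t /\ 2 ^+ k <= t < 2 ^+ k.+1].

(* [T] may be uncountable; one representative per dyadic interval already
   determines the singular set, which is therefore Borel. *)
Lemma Sing_dyadic (tau : nat -> R) :
  (forall k, dyadic_part k !=set0 -> dyadic_part k (tau k)) ->
  Sing r T = \bigcap_m \bigcup_N
    \bigcap_(k in [set k | (N <= k)%N /\ dyadic_part k !=set0])
      approx (tau k) m.+1%:R^-1.
Proof.
move=> htau; apply/seteqP; split => [x Sx m _|x h delta d0].
  have [|T0 hT0] := Sx m.+1%:R^-1; first by rewrite invr_gt0.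
  exists (Num.truncn T0).+1 => // k /= [Nk /htau[Tk /andP[tk _]]].
  apply: hT0 => //; apply: le_trans tk; apply: (@le_trans _ _ k%:R).
    by apply: le_trans (ltW (truncnS_gt T0)) _; rewrite ler_nat.
  by rewrite -natrX ler_nat ltnW// ltn_expl.
(* Half of [delta] is given away because [t] and [tau k] differ by a factor of at most 2. *)
pose m := Num.truncn (2 / delta).
have m0 : 0 < m.+1%:R^-1 :> R by rewrite invr_gt0.
have md : m.+1%:R^-1 <= delta / 2.
  have := truncnS_gt (2 / delta); rewrite -/m => lt.
  have d2 : 0 < 2 / delta by rewrite divr_gt0.
  by rewrite -[leRHS]invrK invf_div lef_pV2 ?posrE// ltW.
have [N _ hN] := h m I; exists (2 ^+ N) => t Tt tN.
have [k /andP[k1 k2]] := pow2_bounds (T_ge1 Tt).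
have Dk : dyadic_part k !=set0 by exists t; split => //; rewrite k1 k2.
have Nk : (N <= k)%N.
  rewrite -ltnS -(ltn_exp2l _ _ (isT : (1 < 2)%N)) -(ltr_nat R) !natrX.
  exact: le_lt_trans tN k2.
have [Ttau /andP[ta1 ta2]] := htau k Dk.
have [p [q [q0 pq qd]]] := hN k (conj Nk Dk).
have t0 : 0 < t by apply: lt_le_trans (T_ge1 Tt).
have tau0 : 0 < tau k by apply: lt_le_trans (T_ge1 Ttau).
move: m.+1%:R^-1 m0 md pq qd => d m0 md pq qd.
move: k1 k2 ta1 ta2; rewrite !exprS => k1 k2 ta1 ta2.
exists p, q; split => //.
  apply: lt_le_trans pq _; rewrite ler_pdivrMr// mulrAC ler_pdivlMr//; nra.
apply: lt_le_trans qd _; nra.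
Qed.

End Approximation.

(** * Singular vectors *)

Section LocalEstimate.
Variables (R : realType) (n : nat).
Variable mu : {measure set (borelRV R n) -> \bar R}.
Variable r : 'I_n -> R.
Hypothesis r_gt0 : forall i, 0 < r i.
Hypothesis r_sum : \sum_(i < n) r i = 1.
Hypothesis mu_nonplanar : nonplanar mu.
Variables (U : set 'rV[R]_n) (C alpha D : R).
Hypotheses (mu_fin : (mu U < +oo)%E) (oU : open U).
Hypotheses (C_gt0 : 0 < C) (alpha_gt0 : 0 < alpha) (D_gt0 : 0 < D).
Hypotheses (fed : federer mu D U) (dec : decaying mu C alpha U).
Variables (z : 'rV[R]_n) (rho : R).
Hypotheses (sz : msupp mu z) (rho_gt0 : 0 < rho).
Hypothesis zU : eball z (7 ^+ n.+3 * rho) `<=` U.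

(** [T0] is independent of [eps]: it only serves to make every lattice function reach 1 on the
    support in the ball. *)
Lemma approx_measure_le : exists T0, forall eps, 0 < eps < 1 ->
  exists2 delta0, 0 < delta0 & forall delta t, 0 < delta -> delta <= delta0 ->
    T0 <= t -> 0 < t ->
    (mu (approx r t delta `&` eball z rho) <=
      (nondiv_const C D n.+2 * eps `^ alpha)%:E * mu (eball z rho))%E.
Proof.
have [c c0 hc] := affine_lower_bound mu_nonplanar sz rho_gt0.
have [m m0 hm] := exists_min_exponent r_gt0.
exists (Num.max 1 (c^-1 `^ m^-1)) => eps /andP[e0 e1].
pose eta := eps / (2 * n.+2%:R).
have n2 : 0 < n.+2%:R :> R by [].
have eta0 : 0 < eta by rewrite divr_gt0// mulr_gt0.
have etae : n.+2%:R * eta < eps.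
  rewrite /eta; move: n.+2%:R n2 => N N0.
  have -> : N * (eps / (2 * N)) = eps / 2 by field; rewrite gt_eqF.
  lra.
exists (\big[Num.min/eta]_i (eta `^ (r i)^-1)).
  by apply: lt_bigmin => // i _; rewrite powR_gt0.
move=> delta t d0 dle; rewrite ge_max => /andP[t1 tc] t0.
have de : delta <= eta by apply: le_trans dle _; exact: bigmin_le_id.
have dre i : delta `^ r i <= eta.
  have : delta <= eta `^ (r i)^-1 by apply: le_trans dle _; exact: bigmin_le.
  move=> /(ge0_ler_powR (ltW (r_gt0 i))) h.
  apply: le_trans (h _ _) _; rewrite ?nnegrE ?powR_ge0 ?(ltW d0)//.
  by rewrite -powRrM mulVf ?gt_eqF// powRr1// ltW.
have e01 : 0 < eps < 1 by rewrite e0.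
pose w := t `^ m.
have w1 : 1 <= w.
  by have := ler_powR t1 (ltW m0); rewrite powRr0.
have wc : 1 <= w * c.
  rewrite -ler_pdivrMr// mul1r.
  have := ge0_ler_powR (ltW m0) _ _ tc; rewrite !nnegrE powR_ge0 (ltW t0).
  by rewrite -powRrM mulVf ?gt_eqF// powRr1 ?invr_ge0 ?(ltW c0)//; apply.
have sw i : w <= scaling r t (lift ord0 i).
  by rewrite /scaling liftK; exact: ler_powR.
have sprod : \prod_l scaling r t l = 1 by exact: scaling_prod.
pose S := approx r t delta.
have mS : borel S by apply: open_borel; exact: approx_open.
have -> : mu (S `&` eball z rho) =
    mu (bad mu (fun L : lattice R n => lpsi (scaling r t) (lmx L)) S eps [::]
      `&` eball z rho).
  rewrite -mu_msupp; last by apply: measurableI => //; exact: eball_borel.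
  by congr (mu _); apply/seteqP; split => [x [[Sx zx] sx]|x [[Sx sx _] zx]].
apply: (@nondivergence R n mu U C alpha D mu_fin oU C_gt0 alpha_gt0 D_gt0 fed dec
  (lattice R n) (fun L => lpsi (scaling r t) (lmx L)) (@lcmp R n) S n.+2) => //.
- by move=> L; exact: lpsi_max_affine.
- exact: lattice_flag_size.
- move=> F x fl Sx hF.
  have [v v0 hv] := approx_short_vector r_gt0 t0 d0 de dre Sx.
  exact: short_vector_chain fl e1 etae v0 hv hF.
move=> L _; have [y [zy sy] Ly] := lpsi_ge1 sprod w1 sw c0 wc hc L.
by exists y.
Qed.

Variable T : set R.
Hypothesis T_ge1 : forall t, T t -> 1 <= t.
Hypothesis T_unbounded : forall M, exists2 t, T t & M <= t.

Lemma Sing_eball_negligible : mu.-negligible (Sing r T `&` eball z rho).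
Proof.
have /choice[tau htau] k : exists t, dyadic_part T k !=set0 -> dyadic_part T k t.
  by have [[t Tt]|nT] := pselect (dyadic_part T k !=set0); [exists t|exists 0].
pose G m N : set 'rV[R]_n :=
  \bigcap_(k in [set k | (N <= k)%N /\ dyadic_part T k !=set0])
    approx r (tau k) m.+1%:R^-1.
have SE : Sing r T = \bigcap_m \bigcup_N G m N by exact: Sing_dyadic.
have mB := @eball_borel R n z rho.
have tau0 k : dyadic_part T k !=set0 -> 0 < tau k.
  by move=> /htau[/T_ge1 ? _]; exact: lt_le_trans ltr01 _.
have mG m N : borel (G m N).
  apply: bigcap_measurableType => k [_ Dk]; apply: open_borel.
  by apply: approx_open => //; exact: tau0.
have mGU m : borel (\bigcup_N G m N) by apply: bigcupT_measurable => N; exact: mG.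
have mSing : borel (Sing r T) by rewrite SE; apply: bigcapT_measurable => m; exact: mGU.
apply/negligibleP; first exact: measurableI.
have finB : mu (eball z rho) \is a fin_num.
  rewrite ge0_fin_numE//; apply: (mu_eball_fin mu_fin oU).
  apply: subset_trans zU; apply: subset_eball.
  rewrite subrr enorm0 add0r ler_peMl// ?(ltW rho_gt0)//.
  by apply: exprn_ege1; rewrite ler1n.
have [T0 hT0] := approx_measure_le.
pose K := nondiv_const C D n.+2.
have K0 : 0 <= K by exact: nondiv_const_ge0.
have bound eps : 0 < eps < 1 ->
    (mu (Sing r T `&` eball z rho) <= (K * eps `^ alpha)%:E * mu (eball z rho))%E.
  move=> e01; have [d d0 hd] := hT0 eps e01.
  pose m := Num.truncn d^-1.
  have md : m.+1%:R^-1 <= d.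
    by rewrite -[leRHS]invrK lef_pV2 ?posrE ?invr_gt0//; exact/ltW/truncnS_gt.
  have GB N : (mu (G m N `&` eball z rho) <=
      (K * eps `^ alpha)%:E * mu (eball z rho))%E.
    (* The first bound gives [tau k >= 2 ^+ k > t / 2 >= T0], the second gives [k >= N]. *)
    have [t Tt tT] := T_unbounded (Num.max (2 * Num.max T0 1) (2 ^+ N.+1)).
    move: tT; rewrite ge_max => /andP[tT tN].
    have [k /andP[k1 k2]] := pow2_bounds (T_ge1 Tt).
    have Dk : dyadic_part T k !=set0 by exists t; split => //; rewrite k1.
    have Nk : (N <= k)%N.
      apply: ltnW; rewrite -ltnS -(ltn_exp2l _ _ (isT : (1 < 2)%N)) -(ltr_nat R).
      by rewrite !natrX; exact: le_lt_trans tN k2.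
    have [_ /andP[ta1 ta2]] := htau k Dk.
    have tt : T0 <= tau k.
      have le1 : T0 <= Num.max T0 1 by rewrite le_max lexx.
      move: k2; rewrite exprS; lra.
    have m0 : 0 < m.+1%:R^-1 :> R by rewrite invr_gt0.
    apply: le_trans (hd m.+1%:R^-1 (tau k) m0 md tt (tau0 k Dk)).
    apply: le_mu; first by apply: measurableI => //; exact: mG.
      apply: measurableI => //; apply: open_borel.
      by apply: approx_open => //; exact: tau0.
    by move=> x [Gx zx]; split => //; exact: Gx.
  apply: (@le_trans _ _ (mu (\bigcup_N (G m N `&` eball z rho)))).
    apply: le_mu; first exact: measurableI.
      by apply: bigcupT_measurable => N; apply: measurableI => //; exact: mG.
    by rewrite SE => x [/(_ m I)[N _ GN] zx]; exists N.
  have mGB N : borel (G m N `&` eball z rho).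
    by apply: measurableI => //; exact: mG.
  have nd : {homo (fun N => G m N `&` eball z rho) : i j / (i <= j)%N >-> (i <= j)%O}.
    move=> i j ij; apply/subsetPset => x [Gx zx]; split => // k [jk Dk].
    by apply: Gx; split => //; exact: leq_trans jk.
  have := nondecreasing_cvg_mu (mu := mu) mGB (bigcupT_measurable _ mGB) nd.
  by apply: cvge_le; apply: nearW => N /=.
apply/eqP; rewrite -measure_le0; apply/lee_addgt0Pr => e e0; rewrite add0e.
move: bound; rewrite -(fineK finB); set M := fine _ => bound.
have M0 : 0 <= M by exact: fine_ge0.
pose eps := Num.min 2^-1 ((e / (K * M + 1)) `^ alpha^-1).
have KM1 : 0 < K * M + 1 by rewrite ltr_wpDl// mulr_ge0.
have q0 : 0 < e / (K * M + 1) by rewrite divr_gt0.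
have eps0 : 0 < eps by rewrite lt_min invr_gt0 ltr0n powR_gt0.
have eps1 : eps < 1.
  by rewrite gt_min invf_lt1 ?ltr1n.
apply: le_trans (bound eps _) _; first by rewrite eps0.
rewrite -EFinM lee_fin.
have ea : eps `^ alpha <= e / (K * M + 1).
  have le : eps <= (e / (K * M + 1)) `^ alpha^-1 by rewrite ge_min lexx orbT.
  have := ge0_ler_powR (ltW alpha_gt0) _ _ le; rewrite !nnegrE powR_ge0 (ltW eps0).
  by rewrite -powRrM mulVf ?gt_eqF// powRr1 ?(ltW q0)//; apply.
rewrite mulrAC; apply: (@le_trans _ _ (K * M * (e / (K * M + 1)))).
  by rewrite ler_wpM2l// mulr_ge0.
rewrite mulrCA ler_piMr ?(ltW e0)// ler_pdivrMr// mul1r; lra.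
Qed.

End LocalEstimate.

Lemma unbounded_ge (R : realType) (T : set R) : (forall t, T t -> 1 <= t) ->
  ~ bounded_set T -> forall M, exists2 t, T t & M <= t.
Proof.
move=> T1 ub M; apply: contrapT => nt; apply: ub; exists M; split.
  exact: num_real.
move=> M' MM' t /= Tt; have t1 := T1 t Tt; rewrite ger0_norm ?(le_trans _ t1)//.
rewrite leNgt; apply/negP => lt; apply: nt; exists t => //.
by apply: ltW; exact: lt_trans lt.
Qed.

Theorem theorem1p1 (R : realType) (n : nat)
    (mu : {measure set (borelRV R n) -> \bar R})
    (mu_lf : locally_finite mu) (mu_friendly : friendly mu)
    (r : 'I_n -> R) (r_gt0 : forall i, 0 < r i)
    (r_sum : \sum_(i < n) r i = 1)
    (T : set R) (T_ge1 : T `<=` `[1, +oo[%classic)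
    (T_unbounded : ~ bounded_set T) :
  mu (Sing r T) = 0%E.
Proof.
have T1 t : T t -> 1 <= t by move=> /T_ge1; rewrite /= in_itv/= andbT.
have Tub := unbounded_ge T1 T_unbounded.
have /choice[tau htau] k : exists t, dyadic_part T k !=set0 -> dyadic_part T k t.
  by have [[t Tt]|nT] := pselect (dyadic_part T k !=set0); [exists t|exists 0].
have mSing : borel (Sing r T).
  rewrite (Sing_dyadic r T1 htau); apply: bigcapT_measurable => m.
  apply: bigcupT_measurable => N; apply: bigcap_measurableType => k [_ Dk].
  apply: open_borel; apply: approx_open => //.
  by have [/T1 ? _] := htau k Dk; exact: lt_le_trans ltr01 _.
apply/negligibleP => //.
have [mu_np mu_ae] := mu_friendly.
pose X := [set x | exists (U : set 'rV[R]_n) (C alpha D : R),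
       [/\ open U, U x, [/\ 0 < C, 0 < alpha & 0 < D],
           federer mu D U & decaying mu C alpha U]].
have nX : mu.-negligible (~` X) by exact: mu_ae.
have nS := msupp_compl_negligible mu.
(* Almost every point lies in the support and has a neighbourhood with the Federer and decay
   conditions, so the claim is local at such points. *)
apply: (@negligibleS _ _ _ mu ((Sing r T `&` (X `&` msupp mu)) `|`
    (~` X `|` ~` msupp mu))).
  move=> x Sx; have [Xx|nXx] := pselect (X x); last by right; left.
  by have [sx|nsx] := pselect (msupp mu x); [left|right; right].
apply: negligibleU; last exact: negligibleU.
apply: locally_negligible => x [[U [C [alpha [D [oU Ux [C0 al0 D0] fed dec]]]]] sx].
have [V [oV Vx Vfin]] := mu_lf x.
(* Both conditions pass to the smaller open set [U]&[V], which has finite measure. *)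
have oUV : open (U `&` V) by exact: openI.
have [e e0 eUV] := open_eball oUV (conj Ux Vx).
pose rho := e / 7 ^+ n.+3.
have w0 : 0 < 7 ^+ n.+3 :> R by rewrite exprn_gt0.
have rho0 : 0 < rho by rewrite divr_gt0.
exists (eball x rho); split; [exact: eball_open|exact: eball_center|].
have UVfin : (mu (U `&` V) < +oo)%E.
  apply: le_lt_trans Vfin; apply: le_mu; [exact: open_borel|exact: open_borel|].
  exact: subIsetr.
apply: (@Sing_eball_negligible R n mu r r_gt0 r_sum mu_np (U `&` V) C alpha D) => //.
- by move=> y s sy [Uy _] s0 sU; apply: fed => // u /sU[].
- by move=> y s L eps sy s0 sU; apply: dec => // u /sU[].
- by rewrite /rho mulrC divfK ?gt_eqF.
Qed.
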